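(* For every threshold $\tau$ and failure probability $\beta\in(0,1)$, there exists a non-interactive linear sketching protocol in the $R$-round linear aggregation model, with per-user communication cost $\tilde{O}\big(\frac{mn}{\tau}\big)$ bits, which solves the $\tau$-heavy hitter problem (with probability at least $1-\beta$). Moreover, the running time of the algorithm is $\tilde{O}\big(\frac{mn}{\tau}\big)$.
   Context: Setting (multi-round linear aggregation model). There are $R$ rounds; in round $r\in[R]$ a set $B_r$ of $n$ users participates, and the sets $B_1,\dots,B_R$ are pairwise disjoint, so there are $N=nR$ users in total. Each user $i$ holds $m_i\le m$ samples from a finite domain $\mathcal{X}$ of size $d$, summarized by a local histogram $h_i:\mathcal{X}\to\mathbb{Z}_{\ge 0}$ with $\|h_i\|_1=m_i\le m$. Let $h^{(r)}=\sum_{i\in B_r}h_i$ and $h^{[R]}=\sum_{r\in[R]}h^{(r)}$. A linear sketching protocol with per-user communication cost $\ell$ bits works as follows: there is shared randomness $U$; in round $r$, each user $i\in B_r$ computes a message $Y_i=f_i(h_i,U)$ in a finite ring $G_r$ (e.g. $\mathbb{Z}_{q_r}^{\ell'}$) whose elements are described by $\ell$ bits, and the server observes only the ring sum $Y^{(r)}=\sum_{i\in B_r}Y_i$. The protocol is non-interactive if the maps $f_i$ are fixed independently of previously observed sums; it is interactive if for $i\in B_r$, $f_i$ may depend on $Y^{(1)},\dots,Y^{(r-1)}$. The server outputs its answer based on the transcript $(Y^{(1)},\dots,Y^{(R)},U)$. The $\tau$-heavy hitter problem: output a set $H\subseteq\mathcal{X}$ such that, with probability at least $1-\beta$, every $x$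 with $h^{[R]}(x)\ge\tau$ lies in $H$ and every $x$ with $h^{[R]}(x)\le\tau/10$ is not in $H$. The notation $\tilde{O}(\cdot)$ suppresses factors polylogarithmic in $m,n,R,N,\tau,d$ and $1/\beta$; running time refers to the computation of users and server.
   Formalization: The bound Õ(mn/τ) is read as polylog·(1 + mn/τ), since bits and steps cannot fall below 1 when τ > mn, and the server's running time is bounded per round rather than in total, since the output alone may contain about Rmn/τ elements. *)

(* Defs.v *)
(* MathComp / MathComp-Analysis. *)
From mathcomp Require Import all_boot all_order all_algebra.
From mathcomp Require Import all_classical all_reals all_analysis.

Set Implicit Arguments.
Unset Strict Implicit.
Unset Printing Implicit Defensive.

Import Order.TTheory GRing.Theory Num.Theory.

Local Open Scope ring_scope.

(** * Linear aggregation over [R] rounds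

   The domain is ['I_d]; user [(r, j)] is the [j]-th member of [B_r], so the
   user sets of distinct rounds are disjoint by construction. *)

Definition hist (d : nat) := {ffun 'I_d -> nat}.

Definition norm1 (d : nat) (h : hist d) : nat := (\sum_(x < d) h x)%N.

Definition dataset (R n d : nat) := 'I_R -> 'I_n -> hist d.

Definition at_most_samples (R n d m : nat) (h : dataset R n d) : Prop :=
  forall r j, (norm1 (h r j) <= m)%N.

Definition total_hist (R n d : nat) (h : dataset R n d) (x : 'I_d) : nat :=
  (\sum_(r < R) \sum_(j < n) h r j x)%N.

(** Non-interactive linear sketching protocols with [l] bits per message and
   [K] uniform shared random bits.  Non-interactivity is built into the type of
   [message], which has no access to the sums of earlier rounds.  The server's
   answer depends on the users only through the ring sums. *)
Record ni_protocol (R n d l K : nat) := NIProtocol {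
  msg_ring : 'I_R -> finPzRingType;
  encode : forall r, msg_ring r -> l.-tuple bool;
  encode_inj : forall r, injective (@encode r);
  message : forall r : 'I_R, 'I_n -> hist d -> K.-tuple bool -> msg_ring r;
  answer : (forall r, msg_ring r) -> K.-tuple bool -> {set 'I_d}
}.

Arguments message {R n d l K} P r _ _ _ : rename.
Arguments encode {R n d l K} P {r} _ : rename.
Arguments answer {R n d l K} P _ _ : rename.

Definition round_sum (R n d l K : nat) (P : ni_protocol R n d l K)
    (h : dataset R n d) (U : K.-tuple bool) (r : 'I_R) : msg_ring P r :=
  \sum_(j < n) message P r j (h r j) U.

Definition run_protocol (R n d l K : nat) (P : ni_protocol R n d l K)
    (h : dataset R n d) (U : K.-tuple bool) : {set 'I_d} :=
  answer P (round_sum P h U) U.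

Definition heavy_hitters_ok (F : realType) (R n d : nat) (tau : F)
    (h : dataset R n d) (H : {set 'I_d}) : bool :=
  [forall x : 'I_d,
     ((tau <= (total_hist h x)%:R) ==> (x \in H)) &&
     (((total_hist h x)%:R <= tau / 10) ==> (x \notin H))].

(** Probability of an event under a uniform [U] in [{0,1}^K]. *)
Definition Prob (F : realType) (K : nat) (E : pred (K.-tuple bool)) : F :=
  #|[pred U | E U]|%:R / #|{: K.-tuple bool}|%:R.

Definition solves_heavy_hitters (F : realType) (R n d l K m : nat)
    (tau beta : F) (P : ni_protocol R n d l K) : Prop :=
  forall h : dataset R n d, at_most_samples m h ->
    1 - beta <= Prob F (fun U => heavy_hitters_ok tau h (run_protocol P h U)).

(** * Machine model

   A random access machine, presented as structured programs over scalar
   variables and finitely many arrays, holding natural numbers and initially 0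
   outside the inputs.  Time is the logarithmic cost: every evaluated node of
   an expression is charged the bit length of its value, hence every operand,
   address and result is paid for.  Up to polylogarithmic factors this is bit
   complexity. *)

Inductive binop := OAdd | OSub | OMul | ODiv | OMod | OLe | OEq.

Definition eval_binop (o : binop) (a b : nat) : nat :=
  match o with
  | OAdd => a + b | OSub => a - b | OMul => a * b
  | ODiv => a %/ b | OMod => a %% b
  | OLe => (a <= b)%N : nat | OEq => (a == b) : nat
  end%N.

Inductive expr :=
  | ECst of nat
  | EVar of nat
  | EGet of nat & expr
  | EBin of binop & expr & expr.

Inductive cmd :=
  | CSkip
  | CSet of nat & expr
  | CPut of nat & expr & expr
  | CSeq of cmd & cmd
  | CIf of expr & cmd & cmd
  | CWhile of expr & cmd.

Record state := State { var : nat -> nat; arr : nat -> nat -> nat }.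

Definition set_var (s : state) (x v : nat) : state :=
  State (fun y => if y == x then v else var s y) (arr s).

Definition set_arr (s : state) (a : nat) (f : nat -> nat) : state :=
  State (var s) (fun b => if b == a then f else arr s b).

Definition set_cell (s : state) (a k v : nat) : state :=
  set_arr s a (fun i => if i == k then v else arr s a i).

Fixpoint eval (s : state) (e : expr) : nat :=
  match e with
  | ECst k => k
  | EVar x => var s x
  | EGet a e1 => arr s a (eval s e1)
  | EBin o e1 e2 => eval_binop o (eval s e1) (eval s e2)
  end.

(** [trunc_log 2 0 = 0], so every value has length at least 1. *)
Definition bitlen (v : nat) : nat := (trunc_log 2 v).+1.

Fixpoint ecost (s : state) (e : expr) : nat :=
  (bitlen (eval s e) +
   match e with
   | ECst _ | EVar _ => 0
   | EGet _ e1 => ecost s e1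
   | EBin _ e1 e2 => ecost s e1 + ecost s e2
   end)%N.

(** [exec c s t s']: from [s], [c] halts in [s'] after time [t]. *)
Inductive exec : cmd -> state -> nat -> state -> Prop :=
  | ExSkip s : exec CSkip s 1 s
  | ExSet x e s : exec (CSet x e) s (ecost s e).+1 (set_var s x (eval s e))
  | ExPut a e1 e2 s :
      exec (CPut a e1 e2) s (ecost s e1 + ecost s e2).+1
        (set_cell s a (eval s e1) (eval s e2))
  | ExSeq c1 c2 s1 s2 s3 t1 t2 :
      exec c1 s1 t1 s2 -> exec c2 s2 t2 s3 ->
      exec (CSeq c1 c2) s1 (t1 + t2).+1 s3
  | ExIf e c1 c2 s s' t :
      exec (if eval s e != 0%N then c1 else c2) s t s' ->
      exec (CIf e c1 c2) s (ecost s e + t).+1 s'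
  | ExWhileStop e c s :
      eval s e = 0%N -> exec (CWhile e c) s (ecost s e).+1 s
  | ExWhileStep e c s1 s2 s3 t1 t2 :
      eval s1 e != 0%N -> exec c s1 t1 s2 -> exec (CWhile e c) s2 t2 s3 ->
      exec (CWhile e c) s1 (ecost s1 e + t1 + t2).+1 s3.

(** * Inputs, outputs and running time

   Variables 0-5 hold [R], [n], [m], [d], [ceil tau] and [ceil (1/beta)].
   Counts being integers, solving the problem for the two ceilings solves it
   for [tau] and [beta].
   Variable 6 holds the round and, for a user, variables 7 and 8 hold the index
   within the round and the number of samples.  Array 0 is the input, array 1
   the shared randomness, array 2 the output; the server's variable 7 is the
   length of its output list. *)

Definition param_values (F : realType) (R n m d : nat) (tau beta : F) :
    seq nat :=
  [:: R; n; m; d; `|Num.ceil tau|%N; `|Num.ceil beta^-1|%N].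

Definition init_state (K : nat) (vs : seq nat) (U : K.-tuple bool) : state :=
  State (fun x => nth 0%N vs x)
        (fun a => if a == 1%N then nth 0%N (map nat_of_bool U)
                  else fun=> 0%N).

(** The samples summarized by [h], in nondecreasing order, so that the input of
   a user is a function of its histogram. *)
Definition samples (d : nat) (h : hist d) : seq nat :=
  flatten [seq nseq (h x) (val x) | x <- enum 'I_d].

Definition user_state (K : nat) (ps : seq nat) (d r j : nat) (h : hist d)
    (U : K.-tuple bool) : state :=
  set_arr (init_state (ps ++ [:: r; j; norm1 h]) U) 0 (nth 0%N (samples h)).

Definition users_run_in (F : realType) (R n d l K m : nat)
    (P : ni_protocol R n d l K) (ps : seq nat) (c : cmd) (B : F) : Prop :=
  forall (r : 'I_R) (j : 'I_n) (h : hist d) (U : K.-tuple bool),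
    (norm1 h <= m)%N ->
    exists t s, [/\ exec c (user_state ps r j h U) t s,
      t%:R <= B &
      encode P (message P r j h U) = [tuple arr s 2 i != 0%N | i < l]].

Definition load_round (s : state) (r : nat) (y : seq bool) : state :=
  set_arr (set_var s 6 r) 0 (nth 0%N (map nat_of_bool y)).

(** Running [c] once for each of the received sums [ys], from round [r] on,
   with memory kept between rounds and time at most [B] in every round.  The
   bound is per round because the answer alone may have [R m n / tau] elements. *)
Fixpoint serves_in (F : realType) (c : cmd) (B : F) (r : nat)
    (ys : seq (seq bool)) (s s' : state) : Prop :=
  match ys with
  | [::] => s' = s
  | y :: ys' => exists t s1,
      [/\ exec c (load_round s r y) t s1, t%:R <= B &
          serves_in c B r.+1 ys' s1 s']
  end.

Definition server_runs_in (F : realType) (R n d l K m : nat)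
    (P : ni_protocol R n d l K) (ps : seq nat) (c : cmd) (B : F) : Prop :=
  forall (h : dataset R n d) (U : K.-tuple bool), at_most_samples m h ->
    exists s,
      serves_in c B 0
        [seq tval (encode P (round_sum P h U r)) | r <- enum 'I_R]
        (init_state ps U) s /\
      mkseq (arr s 2) (var s 7) =i [seq val x | x <- enum (run_protocol P h U)].

(** [polylog * (1 + mn/tau)].  The summand 1 matters only for [tau > mn], where
   a number of bits or steps cannot be a vanishing fraction. *)
Definition otilde_bound (F : realType) (C : F) (c R n m d : nat)
    (tau beta : F) : F :=
  let N := (n * R)%N in
  C * ln (2 + m%:R + n%:R + R%:R + N%:R + tau + d%:R + beta^-1) ^+ c
    * (1 + m%:R * n%:R / tau).

(* Main.v *)
From HB Require Import structures.
Require Import Defs.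
From mathcomp Require Import all_boot all_order all_algebra.
From mathcomp Require Import all_classical all_reals all_analysis.
From mathcomp Require Import zify ring lra.
(* Takes [eval] back from MathComp-Analysis. *)
Import Defs.

(** Sampling replaces sketching: since the users' messages are added up but
    user [j] of a round knows its own index, the message can be split into slots
    with a public owner, and then the sum is a concatenation.  With
    [2 ^ t] slightly above [tau], the [n m] sample positions of a round are cut
    into blocks of length [2 ^ t]; each of [40 c] slots per block probes a uniform
    position of its block, drawn from the shared randomness, and the user owning
    that position writes the sample it holds there.  The total number of probes
    hitting [x] is a sum of independent indicators of mean
    [40 c h(x) / 2 ^ t], which is at least [20 c] if [h(x) >= tau] and at most
    [4 c] if [h(x) <= tau / 10].  Reporting the [x] with at least [8 c] hits thus
    fails for a given [x] with probability at most [2 ^ - c], by the exponential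
    moment method, and [c] is chosen with [2 ^ c > d / beta].  *)

Set Implicit Arguments.
Unset Strict Implicit.
Unset Printing Implicit Defensive.

Import Order.TTheory GRing.Theory Num.Theory.

Local Open Scope nat_scope.

(** * Running time of loop-free code and of loops *)

Lemma ltn_bitlen v : v < 2 ^ bitlen v.
Proof. exact: trunc_log_ltn. Qed.

Lemma bitlen_gt0 v : 0 < bitlen v. Proof. by []. Qed.

Lemma bitlen_leq v w : v < 2 ^ w -> 0 < w -> bitlen v <= w.
Proof.
case: v => [|v] // lt_vw _.
by rewrite /bitlen -(@ltn_exp2l 2) // (leq_ltn_trans _ lt_vw) // trunc_logP.
Qed.

Definition bounded (w : nat) (s : state) : Prop :=
  (forall x, var s x < 2 ^ w) /\ (forall a i, arr s a i < 2 ^ w).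

Lemma bounded_set_var w s x v :
  bounded w s -> v < 2 ^ w -> bounded w (set_var s x v).
Proof. by case=> bv ba lt_v; split=> // y /=; case: eqP. Qed.

Lemma bounded_set_cell w s a k v :
  bounded w s -> v < 2 ^ w -> bounded w (set_cell s a k v).
Proof.
by case=> bv ba lt_v; split=> //= b i; case: eqP => // _; case: eqP.
Qed.

Lemma boundedW w1 w2 s : w1 <= w2 -> bounded w1 s -> bounded w2 s.
Proof.
have p2 : w1 <= w2 -> 2 ^ w1 <= 2 ^ w2 by exact: leq_pexp2l.
move=> /p2 le12 [bv ba].
by split=> [x|a i]; [exact: leq_trans (bv x) le12 | exact: leq_trans (ba a i) le12].
Qed.

(** [esize e * w] bounds the bit length of [e], hence of all its subterms, over
    memories of [w]-bit words. *)
Fixpoint esize (e : expr) : nat :=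
  match e with
  | ECst k => k.+1
  | EVar _ => 1
  | EGet _ e1 => (esize e1).+1
  | EBin _ e1 e2 => esize e1 + esize e2
  end.

Lemma esize_gt0 e : 0 < esize e.
Proof. by elim: e => //= o e1 h1 e2 h2; rewrite addn_gt0 h1. Qed.

(** Positive lengths let the truth value 1 of a comparison fit, also when both operands are 0. *)
Lemma eval_binop_lt o a b x y :
  0 < x -> 0 < y -> a < 2 ^ x -> b < 2 ^ y -> eval_binop o a b < 2 ^ (x + y).
Proof.
move=> x0 y0 ax byy; have two n : 0 < n -> 2 <= 2 ^ n.
  by move=> n0; rewrite -{1}(expn1 2) leq_pexp2l.
have [x2 y2] := (two _ x0, two _ y0).
have ax' : a < 2 ^ (x + y).
  by rewrite (leq_trans ax) // leq_pexp2l // leq_addr.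
have xy2 : 1 < 2 ^ (x + y) by apply: two; rewrite addn_gt0 x0.
case: o => /=.
- rewrite expnD; nia.
- by rewrite (leq_ltn_trans _ ax') // leq_subr.
- rewrite expnD; nia.
- by rewrite (leq_ltn_trans _ ax') // leq_div.
- by rewrite (leq_ltn_trans _ ax') // leq_mod.
- by case: (a <= b); lia.
- by case: (a == b); lia.
Qed.

Lemma eval_lt w s e : 0 < w -> bounded w s -> eval s e < 2 ^ (esize e * w).
Proof.
move=> w0 [bv ba]; elim: e => [k|x|a e1 h1|o e1 h1 e2 h2] /=.
- rewrite (leq_trans (ltn_expl k (isT : 1 < 2))) // leq_pexp2l //; nia.
- by rewrite mul1n.
- by rewrite (leq_trans (ba _ _)) // leq_pexp2l // mulSn leq_addr.
- by rewrite mulnDl eval_binop_lt // muln_gt0 esize_gt0.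
Qed.

(** A node costs at most its own size times [w]; the induction closes because [x + y <= 2 * x * y]
    for positive sizes. *)
Lemma ecost_le w s e : 0 < w -> bounded w s -> ecost s e <= esize e ^ 2 * w.
Proof.
move=> w0 bs; have node e' : bitlen (eval s e') <= esize e' * w.
  by rewrite bitlen_leq ?eval_lt // muln_gt0 esize_gt0.
elim: e => [k|x|a e1 h1|o e1 h1 e2 h2] /=; move: node.
- by move=> /(_ (ECst k)) /=; nia.
- by move=> /(_ (EVar x)) /=; nia.
- by move=> /(_ (EGet a e1)) /=; nia.
- move=> /(_ (EBin o e1 e2)) /= h.
  have := esize_gt0 e1; have := esize_gt0 e2.
  move: (esize e1) (esize e2) h1 h2 h => x y; nia.
Qed.

Fixpoint loopfree (c : cmd) : bool :=
  match c with
  | CSkip | CSet _ _ | CPut _ _ _ => true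
  | CSeq c1 c2 | CIf _ c1 c2 => loopfree c1 && loopfree c2
  | CWhile _ _ => false
  end.

(** Execution of loop-free code as a function, so that symbolic runs are done by simplification. The
    [CWhile] case is a default value, kept out by [loopfree] in [runs_step]. *)
Fixpoint step (c : cmd) (s : state) : state :=
  match c with
  | CSkip => s
  | CSet x e => set_var s x (eval s e)
  | CPut a e1 e2 => set_cell s a (eval s e1) (eval s e2)
  | CSeq c1 c2 => step c2 (step c1 s)
  | CIf e c1 c2 => if eval s e != 0 then step c1 s else step c2 s
  | CWhile _ _ => s
  end.

(** Factor by which a loop-free command can lengthen the words in memory. *)
Fixpoint stretch (c : cmd) : nat :=
  match c with
  | CSkip | CWhile _ _ => 1
  | CSet _ e | CPut _ _ e => esize e
  | CSeq c1 c2 => stretch c1 * stretch c2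
  | CIf _ c1 c2 => stretch c1 + stretch c2
  end.

(** In a sequence the second command works on words lengthened by the first, whence the factor
    [stretch c1]. *)
Fixpoint unit_cost (c : cmd) : nat :=
  match c with
  | CSkip | CWhile _ _ => 1
  | CSet _ e => (esize e ^ 2).+1
  | CPut _ e1 e2 => (esize e1 ^ 2 + esize e2 ^ 2).+1
  | CSeq c1 c2 => (unit_cost c1 + unit_cost c2 * stretch c1).+1
  | CIf e c1 c2 => (esize e ^ 2 + (unit_cost c1 + unit_cost c2)).+1
  end.

Lemma stretch_gt0 c : 0 < stretch c.
Proof.
elim: c => //= *; rewrite ?esize_gt0 ?muln_gt0 ?addn_gt0 //.
- exact/andP.
- exact/orP/or_introl.
Qed.

Lemma bounded_step w c s :
  0 < w -> bounded w s -> bounded (stretch c * w) (step c s).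
Proof.
elim: c w s => [|x e|a e1 e2|c1 h1 c2 h2|e c1 h1 c2 h2|e c _] w s w0 bs /=;
  rewrite ?mul1n //.
- apply: bounded_set_var; last exact: eval_lt.
  by apply: boundedW bs; rewrite leq_pmull ?esize_gt0.
- apply: bounded_set_cell; last exact: eval_lt.
  by apply: boundedW bs; rewrite leq_pmull ?esize_gt0.
- rewrite mulnAC mulnC.
  by apply: h2; [rewrite muln_gt0 stretch_gt0 | exact: h1].
- case: ifP => _; [apply: boundedW (h1 w s w0 bs)|apply: boundedW (h2 w s w0 bs)];
  by rewrite leq_mul2r ?leq_addr ?leq_addl orbT.
Qed.

Definition runs (c : cmd) (s : state) (T : nat) (s' : state) : Prop :=
  exists2 t, exec c s t s' & t <= T.

Lemma runs_step w c s : 0 < w -> loopfree c -> bounded w s ->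
  runs c s (unit_cost c * w) (step c s).
Proof.
elim: c w s => [|x e|a e1 e2|c1 h1 c2 h2|e c1 h1 c2 h2|e c _] w s w0 //=.
- by move=> _ _; exists 1; [constructor | rewrite mul1n].
- move=> _ bs; exists (ecost s e).+1; first by constructor.
  by have := ecost_le e w0 bs; nia.
- move=> _ bs; exists (ecost s e1 + ecost s e2).+1; first by constructor.
  by have := ecost_le e1 w0 bs; have := ecost_le e2 w0 bs; nia.
- case/andP=> l1 l2 bs; have [t1 x1 le1] := h1 w s w0 l1 bs.
  have w1 : 0 < stretch c1 * w by rewrite muln_gt0 stretch_gt0.
  have [t2 x2 le2] := h2 _ _ w1 l2 (bounded_step c1 w0 bs).
  by exists (t1 + t2).+1; [apply: ExSeq x1 x2 | nia].
- case/andP=> l1 l2 bs; have le0 := ecost_le e w0 bs.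
  case: ifP => ne.
  + have [t x1 le1] := h1 w s w0 l1 bs.
    by exists (ecost s e + t).+1; [apply: ExIf; rewrite ne | nia].
  + have [t x1 le1] := h2 w s w0 l2 bs.
    by exists (ecost s e + t).+1; [apply: ExIf; rewrite ne | nia].
Qed.

Lemma runs_seq c1 c2 s1 s2 s3 T1 T2 :
  runs c1 s1 T1 s2 -> runs c2 s2 T2 s3 -> runs (CSeq c1 c2) s1 (T1 + T2).+1 s3.
Proof.
case=> t1 x1 le1 [t2 x2 le2]; exists (t1 + t2).+1; first exact: ExSeq x1 x2.
by rewrite ltnS leq_add.
Qed.

(** Loop rule with an exact iteration count: the invariant carries the index, and the guard is true
    precisely below [N]. The invariant must restore [bounded w] at each turn, since otherwise the
    [stretch] of the body would compound. *)
Lemma runs_while w e c T N (I : nat -> state -> Prop) s : 0 < w ->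
  (forall i s, i <= N -> I i s -> bounded w s /\ (eval s e != 0) = (i < N)) ->
  (forall i s, i < N -> I i s -> exists2 s', runs c s T s' & I i.+1 s') ->
  I 0 s ->
  exists2 s', runs (CWhile e c) s (N.+1 * (esize e ^ 2 * w + T).+1) s' & I N s'.
Proof.
move=> w0 guard body I0.
suff H k : forall i s, i + k = N -> I i s -> exists2 s',
  runs (CWhile e c) s (k.+1 * (esize e ^ 2 * w + T).+1) s' & I N s' by exact: H I0.
elim: k => [|k IHk] i s' Nik Ii.
  rewrite addn0 in Nik; have [bs] := guard i s' (eq_leq Nik) Ii.
  rewrite Nik ltnn => /negbFE/eqP ev0; exists s'; last by rewrite -Nik.
  by exists (ecost s' e).+1; [constructor | have := ecost_le e w0 bs; nia].
have iN : i < N by lia.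
have [bs ev] := guard i s' (ltnW iN) Ii; rewrite iN in ev.
have [s1 [t1 x1 le1] I1] := body _ _ iN Ii.
have [|s2 [t2 x2 le2] I2] := IHk i.+1 s1 _ I1; first by lia.
exists s2 => //; exists (ecost s' e + t1 + t2).+1; first exact: ExWhileStep ev x1 x2.
have := ecost_le e w0 bs; nia.
Qed.

(** * Program fragments *)

Lemma runsW c s T T' s' : T <= T' -> runs c s T s' -> runs c s T' s'.
Proof. by move=> le_T [t x le_t]; exists t => //; exact: leq_trans le_t le_T. Qed.

Definition agree_off (xs : seq nat) (s s' : state) : Prop :=
  (forall x, x \notin xs -> var s' x = var s x) /\ arr s' = arr s.

Declare Scope prog_scope.
Local Open Scope prog_scope.
Local Notation "# k" := (ECst k) (at level 5, k at level 0, format "# k") : prog_scope.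
Local Notation "$ x" := (EVar x) (at level 5, x at level 0, format "$ x") : prog_scope.
Local Notation "a [+] b" := (EBin OAdd a b) (at level 50, left associativity) : prog_scope.
Local Notation "a [-] b" := (EBin OSub a b) (at level 50, left associativity) : prog_scope.
Local Notation "a [*] b" := (EBin OMul a b) (at level 40, left associativity) : prog_scope.
Local Notation "a [/] b" := (EBin ODiv a b) (at level 40, left associativity) : prog_scope.
Local Notation "a [%] b" := (EBin OMod a b) (at level 40, left associativity) : prog_scope.
Local Notation "a [<=] b" := (EBin OLe a b) (at level 70, no associativity) : prog_scope.
Local Notation "a [=] b" := (EBin OEq a b) (at level 70, no associativity) : prog_scope.
Local Notation "x ::= e" := (CSet x e) (at level 80, no associativity) : prog_scope.
Local Notation "c1 ;; c2" := (CSeq c1 c2) (at level 90, right associativity) : prog_scope.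

Definition log_prog (x k p : nat) : cmd :=
  (k ::= #1 ;; p ::= #2) ;;
  CWhile ($p [<=] $x) (p ::= #2 [*] $p ;; k ::= $k [+] #1).

Lemma leq_exp_trunc_log v i : (2 ^ i.+1 <= v) = (i < trunc_log 2 v).
Proof.
case: v => [|v]; first by rewrite trunc_log0 leqn0 expn_eq0.
apply/idP/idP => [le_v|lt_i]; first exact: trunc_log_max.
by apply: leq_trans (trunc_logP (isT : 1 < 2) (ltn0Sn v)); rewrite leq_exp2l.
Qed.

(** The strict bound on the bit length leaves room for the final power of two, which is one bit
    longer than [x]. *)
Lemma runs_log x k p w s : uniq [:: x; k; p] -> bitlen (var s x) < w ->
  bounded w s ->
  exists2 s', runs (log_prog x k p) s (100 * w ^ 2) s' &
    [/\ var s' k = bitlen (var s x), var s' p = 2 ^ bitlen (var s x),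
        agree_off [:: k; p] s s' & bounded w s'].
Proof.
rewrite /= !inE !negb_or !andbT => /andP[/andP[xk xp] kp] lt_w bs.
have w0 : 0 < w by apply: leq_ltn_trans lt_w.
have pow i : i <= bitlen (var s x) -> 2 ^ i < 2 ^ w.
  by move=> le_i; rewrite ltn_exp2l // (leq_ltn_trans le_i).
have small i : i <= bitlen (var s x) -> i < 2 ^ w.
  by move=> le_i; rewrite (leq_trans _ (ltnW (ltn_expl w (isT : 1 < 2)))) // (leq_ltn_trans le_i).
set N := trunc_log 2 (var s x).
pose I i s' := [/\ var s' k = i.+1, var s' p = 2 ^ i.+1,
  agree_off [:: k; p] s s' & bounded w s'].
have off s' : agree_off [:: k; p] s s' -> var s' x = var s x.
  by case=> /(_ x) -> //; rewrite !inE negb_or xk.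
(* After [i] turns [k] is [i + 1]; 58 is the [unit_cost] of the body. *)
have [|i s' le_i [vk vp ag bs']|i s' lt_i [vk vp ag bs']||s' r' I'] :=
  @runs_while w ($p [<=] $x) (p ::= #2 [*] $p ;; k ::= $k [+] #1) (58 * w) N I
    (step (k ::= #1 ;; p ::= #2) s).
- exact: w0.
- split=> //=; rewrite vp (off _ ag) leq_exp_trunc_log.
  by case: (i < _).
- have bs1 : bounded w (step (p ::= #2 [*] $p ;; k ::= $k [+] #1) s').
    rewrite /= !(negbTE kp) vk vp.
    apply: bounded_set_var; first apply: bounded_set_var => //.
      by rewrite -expnS pow // /bitlen ltnS.
    by rewrite addn1 small // /bitlen ltnS.
  exists (step (p ::= #2 [*] $p ;; k ::= $k [+] #1) s').
    by apply: runsW (@runs_step w _ _ w0 _ bs').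
  split=> //=.
  + by rewrite eqxx (negbTE kp) vk addn1.
  + by rewrite eq_sym (negbTE kp) eqxx vp -expnS.
  + case: ag => agv aga; split=> //= y; rewrite !inE negb_or => /andP[yk yp].
    by rewrite (negbTE yk) (negbTE yp) agv // !inE negb_or yk.
- split=> //=.
  + by rewrite eqxx (negbTE kp).
  + by rewrite eqxx.
  + by split=> //= y; rewrite !inE negb_or => /andP[/negbTE-> /negbTE->].
  + apply: bounded_set_var; first apply: bounded_set_var => //.
      exact: small.
    by rewrite (pow 1).
exists s'; last exact I'.
have r0 := @runs_step w (k ::= #1 ;; p ::= #2) s w0 isT bs.
apply: runsW (runs_seq r0 r').
have : N.+1 <= w := ltnW lt_w.
rewrite [unit_cost _]/= [esize _]/=; move: N.+1 => M; nia.
Qed.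

(** The bit at index 0 is the most significant one. *)
Definition bitsval (f : nat -> nat) (k : nat) : nat :=
  foldl (fun v b => v.*2 + b) 0 (mkseq f k).

Lemma bitsvalS f k : bitsval f k.+1 = (bitsval f k).*2 + f k.
Proof. by rewrite /bitsval mkseqS foldl_rcons. Qed.

Lemma bitsval_lt f k : (forall i, f i <= 1) -> bitsval f k < 2 ^ k.
Proof.
move=> f1; elim: k => // k IHk; rewrite bitsvalS expnS -muln2.
by have := f1 k; nia.
Qed.

Definition read_bits (a : nat) (base : expr) (len : nat) : cmd :=
  (22 ::= #0 ;; 21 ::= #0) ;;
  CWhile ($22 [+] #1 [<=] $len)
    (21 ::= #2 [*] $21 [+] EGet a (base [+] $22) ;; 22 ::= $22 [+] #1).

(** Horner evaluation in variable 21. The base address must be independent of the two loop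
    variables, and [esize base <= 4] keeps the [unit_cost] of the body at 202 or less, which 1000
    absorbs. *)
Lemma runs_read_bits a base len w s : esize base <= 4 ->
  len \notin [:: 21; 22] -> var s len < w -> bounded w s ->
  (forall i, arr s a i <= 1) ->
  (forall s', agree_off [:: 21; 22] s s' -> eval s' base = eval s base) ->
  exists2 s', runs (read_bits a base len) s (1000 * w ^ 2) s' &
    [/\ var s' 21 = bitsval (fun i => arr s a (eval s base + i)) (var s len),
        agree_off [:: 21; 22] s s' & bounded w s'].
Proof.
move=> sz lenN lt_w bs a1 base_const.
have w0 : 0 < w by apply: leq_ltn_trans lt_w.
set f := fun i => arr s a _; set N := var s len.
pose I i s' := [/\ var s' 22 = i, var s' 21 = bitsval f i,
  agree_off [:: 21; 22] s s' & bounded w s'].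
set body := (21 ::= #2 [*] $21 [+] EGet a (base [+] $22) ;; 22 ::= $22 [+] #1).
have f1 i : f i <= 1 by apply: a1.
have pow i : i <= N -> i < 2 ^ w.
  move=> le_i; rewrite (leq_trans _ (ltnW (ltn_expl w (isT : 1 < 2)))) //.
  exact: leq_ltn_trans le_i lt_w.
have [|i s' le_i [v22 v21 ag bs']|i s' lt_i [v22 v21 ag bs']||s' r' I'] :=
  @runs_while w ($22 [+] #1 [<=] $len) body (unit_cost body * w) N I
    (step (22 ::= #0 ;; 21 ::= #0) s).
- exact: w0.
- split=> //=; rewrite v22 (ag.1 _ lenN) addn1 -/N.
  by case: (i < _).
- have E : step body s' =
      set_var (set_var s' 21 (bitsval f i.+1)) 22 i.+1.
    by rewrite /= v22 v21 (base_const _ ag) ag.2 bitsvalS addn1 mul2n.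
  have bs1 : bounded w (step body s').
    rewrite E; apply: bounded_set_var; first apply: bounded_set_var => //.
      apply: leq_trans (bitsval_lt _ f1) _; rewrite leq_exp2l //.
      by apply: leq_trans (ltnW lt_w).
    exact: pow.
  exists (step body s'); first exact: runs_step.
  rewrite E in bs1 *; split=> //=.
  case: ag => agv aga; split=> //= y; rewrite !inE negb_or => /andP[y1 y2].
  by rewrite (negbTE y1) (negbTE y2) agv // !inE negb_or y1.
- split=> //=.
  + by split=> //= y; rewrite !inE negb_or => /andP[/negbTE-> /negbTE->].
  + apply: bounded_set_var; first apply: bounded_set_var => //;
    by rewrite expn_gt0.
exists s'; last by case: I' => _ v21 ag bs'; split.
have r0 := @runs_step w (22 ::= #0 ;; 21 ::= #0) s w0 isT bs.
apply: runsW (runs_seq r0 r').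
have le_body : unit_cost body <= 202 by rewrite /=; nia.
have : N.+1 <= w by [].
rewrite [unit_cost (_ ;; _)]/= [esize _]/=.
move: (unit_cost body) le_body N.+1 => B leB M leM.
have : M.+1 * (4 ^ 2 * w + B * w).+1 <= (w + 1) * (219 * w).
  apply: leq_mul; first by lia.
  nia.
nia.
Qed.

(** * Parameters of the protocol *)

Lemma agree_offW xs ys s s' :
  all [in ys] xs -> agree_off xs s s' -> agree_off ys s s'.
Proof.
move=> /allP sub [agv aga]; split=> // x xN; apply: agv.
by apply: contra xN => /sub.
Qed.

Lemma agree_off_trans xs s1 s2 s3 :
  agree_off xs s1 s2 -> agree_off xs s2 s3 -> agree_off xs s1 s3.
Proof.
move=> [v12 a12] [v23 a23]; split; last by rewrite a23.
by move=> x xN; rewrite v23 ?v12.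
Qed.

Lemma agree_off_set xs s s' x v :
  x \in xs -> agree_off xs s s' -> agree_off xs s (set_var s' x v).
Proof.
move=> x_in [agv aga]; split=> //= y yN.
by case: eqP yN => [->|_ /agv->] //; rewrite x_in.
Qed.

Record params := Params { pR : nat; pn : nat; pm : nat; pd : nat; pT : nat; pb : nat }.

Definition param_seq (p : params) : seq nat :=
  [:: pR p; pn p; pm p; pd p; pT p; pb p].

(** The exponent [c] of the tail bounds: a failure rate of [2 ^ - c] per element survives a union
    bound over [pd p] elements. *)
Definition conf (p : params) : nat := bitlen (pb p * pd p).
Definition blk (p : params) : nat := bitlen (pT p).
(** A slot holds a number from 0 to [pd p]: 0 for an empty probe, [x + 1] for the sample [x]. *)
Definition width (p : params) : nat := bitlen (pd p).
Definition reps (p : params) : nat := 40 * conf p.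
(** The extra block covers the incomplete end of the [n * m] positions. *)
Definition blocks (p : params) : nat := pn p * pm p %/ 2 ^ blk p + 1.
Definition slots (p : params) : nat := reps p * blocks p.

(** All words in memory stay below a polynomial in [2 ^ word0], which bounds the
    parameters; the exponent 20 is generous. *)
Definition word0 (p : params) : nat :=
  bitlen (pR p) + bitlen (pn p) + bitlen (pm p) + bitlen (pd p) + bitlen (pT p)
  + bitlen (pb p).
Definition word (p : params) : nat := 20 * word0 p.

Lemma word0_ge6 p : 6 <= word0 p.
Proof.
rewrite /word0.
by have := (bitlen_gt0 (pR p), bitlen_gt0 (pn p), bitlen_gt0 (pm p)); case=> -[? ?] ?;
have := (bitlen_gt0 (pd p), bitlen_gt0 (pT p), bitlen_gt0 (pb p)); case=> -[? ?] ?; lia.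
Qed.

Lemma word_gt0 p : 0 < word p.
Proof. by have := word0_ge6 p; rewrite /word; lia. Qed.

(** Reduces overflow checks to counting degrees of polynomials in [2 ^ word0 p]. *)
Lemma lt_word p v e : v < (2 ^ word0 p) ^ e -> e <= 20 -> v < 2 ^ word p.
Proof.
move=> lt_v le_e; apply: leq_trans lt_v _.
by rewrite -expnM /word mulnC leq_exp2l // leq_mul2r le_e orbT.
Qed.

Lemma params_lt p : [/\ pR p < 2 ^ word0 p, pn p < 2 ^ word0 p,
  pm p < 2 ^ word0 p & [/\ pd p < 2 ^ word0 p, pT p < 2 ^ word0 p & pb p < 2 ^ word0 p]].
Proof.
have H v k : bitlen v <= k -> v < 2 ^ k.
  by move=> le_k; apply: leq_trans (ltn_bitlen v) _; rewrite leq_exp2l.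
by split; [..|split]; apply: H; rewrite /word0; lia.
Qed.

Lemma base_ge64 p : 64 <= 2 ^ word0 p.
Proof. by apply: (@leq_trans (2 ^ 6)); rewrite ?leq_exp2l ?word0_ge6. Qed.

Lemma conf_le p : conf p <= 2 * word0 p.
Proof.
case: (params_lt p) => _ _ _ [dX _ bX].
apply: bitlen_leq; last by have := word0_ge6 p; lia.
by rewrite [2 * word0 p]mulnC expnM expnS expn1; nia.
Qed.

Lemma blk_le p : blk p <= word0 p. Proof. by rewrite /word0 /blk; lia. Qed.
Lemma width_le p : width p <= word0 p. Proof. by rewrite /word0 /width; lia. Qed.
Lemma width_gt0 p : 0 < width p. Proof. by []. Qed.
Lemma reps_gt0 p : 0 < reps p. Proof. by rewrite muln_gt0. Qed.

Lemma conf_lt p : conf p < word p.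
Proof. by have := conf_le p; have := word0_ge6 p; rewrite /word; lia. Qed.
Lemma blk_lt p : blk p < word p.
Proof. by have := blk_le p; have := word0_ge6 p; rewrite /word; lia. Qed.
Lemma width_lt p : width p < word p.
Proof. by have := width_le p; have := word0_ge6 p; rewrite /word; lia. Qed.

Lemma conf_base p : conf p <= (2 ^ word0 p) ^ 2.
Proof.
apply: leq_trans (conf_le p) _; have := base_ge64 p.
by have := ltn_expl (word0 p) (isT : 1 < 2); rewrite expnS expn1; nia.
Qed.

Lemma blocks_base p : blocks p <= (2 ^ word0 p) ^ 2.
Proof.
case: (params_lt p) => _ nX mX _.
rewrite /blocks; apply: (@leq_trans (pn p * pm p + 1)); first by rewrite leq_add2r leq_div.
by rewrite expnS expn1; nia.
Qed.

Lemma slots_base p : slots p <= (2 ^ word0 p) ^ 5.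
Proof.
rewrite (expnD _ 3 2) leq_mul ?blocks_base //.
by rewrite (expnD _ 1 2) expn1 leq_mul ?conf_base // (leq_trans _ (base_ge64 p)).
Qed.

Lemma reps_lt p : reps p < 2 ^ word p.
Proof.
apply: (@lt_word p _ 4) => //; have := conf_base p; have := base_ge64 p.
by rewrite /reps !expnS expn0 muln1; nia.
Qed.

Lemma slots_lt p : slots p < 2 ^ word p.
Proof.
apply: (@lt_word p _ 6) => //; apply: leq_ltn_trans (slots_base p) _.
by rewrite ltn_exp2l // (leq_trans _ (base_ge64 p)).
Qed.

(** Keeps the tally counters and the output length of the server within a word over all rounds. *)
Lemma rounds_slots_lt p : pR p * slots p < 2 ^ word p.
Proof.
case: (params_lt p) => RX _ _ _; apply: (@lt_word p _ 6) => //.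
rewrite expnS; have := slots_base p; have : 0 < (2 ^ word0 p) ^ 5 by rewrite !expn_gt0.
by nia.
Qed.

Lemma param_lt_word p v : v \in param_seq p -> v.+1 < 2 ^ word p.
Proof.
move=> v_in; apply: (@lt_word p _ 2) => //.
have : v < 2 ^ word0 p.
  case: (params_lt p) => ? ? ? [? ? ?].
  by move: v_in; rewrite !inE; do 5![case/predU1P=> [-> //|]]; move/eqP->.
by have := base_ge64 p; rewrite expnS expn1; nia.
Qed.

(** Variables 11, 13, 14, 15, 17 and 18 receive [conf], [blk], [2 ^ blk],
    [width], [reps] and [slots]; see [ready]. *)
Definition prep1 : cmd := 10 ::= $5 [*] $3.
Definition prep2 : cmd :=
  17 ::= #40 [*] $11 ;; 18 ::= $17 [*] ($1 [*] $2 [/] $14 [+] #1).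
Definition prep : cmd :=
  prep1 ;; log_prog 10 11 12 ;; log_prog 4 13 14 ;; log_prog 3 15 16 ;; prep2.

Definition has_params (p : params) (s : state) : Prop :=
  forall x, x < 6 -> var s x = nth 0 (param_seq p) x.

Definition ready (p : params) (s0 s : state) : Prop :=
  [/\ agree_off (iota 10 9) s0 s, bounded (word p) s,
      [/\ var s 11 = conf p, var s 13 = blk p & var s 14 = 2 ^ blk p] &
      [/\ var s 15 = width p, var s 17 = reps p & var s 18 = slots p]].

(** The 304 stands for three runs of [log_prog] at 100 each and four sequencing steps. *)
Definition prep_cost : nat := unit_cost prep1 + unit_cost prep2 + 304.

Lemma runs_prep p s : has_params p s -> bounded (word p) s ->
  exists2 s', runs prep s (prep_cost * word p ^ 2) s' & ready p s s'.
Proof.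
move=> hp bs; have w0 := word_gt0 p.
have [v1 v2 v3] : [/\ var s 1 = pn p, var s 2 = pm p & var s 3 = pd p].
  by rewrite !hp.
have [v4 v5] : var s 4 = pT p /\ var s 5 = pb p by rewrite !hp.
case: (params_lt p) => _ _ _ [dX _ bX].
have r1 := @runs_step (word p) prep1 s w0 isT bs.
have b1 : bounded (word p) (step prep1 s).
  apply: bounded_set_var => //=; rewrite v3 v5.
  by apply: (@lt_word p _ 2) => //; rewrite expnS expn1; nia.
have [||//|s2 r2 [e11 _ ag2 b2]] := @runs_log 10 11 12 (word p) (step prep1 s).
  by [].
  by rewrite /= v3 v5 conf_lt.
have [||//|s3 r3 [e13 e14 ag3 b3]] := @runs_log 4 13 14 (word p) s2.
  by [].
  by rewrite ag2.1 //= v4 blk_lt.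
have [||//|s4 r4 [e15 _ ag4 b4]] := @runs_log 3 15 16 (word p) s3.
  by [].
  by rewrite ag3.1 // ag2.1 //= v3 width_lt.
have {}e11 : var s4 11 = conf p by rewrite ag4.1 // ag3.1 // e11 /= v3 v5.
have {}e13 : var s4 13 = blk p by rewrite ag4.1 // e13 ag2.1 //= v4.
have {}e14 : var s4 14 = 2 ^ blk p by rewrite ag4.1 // e14 ag2.1 //= v4.
have {}e15 : var s4 15 = width p by rewrite e15 ag3.1 // ag2.1 //= v3.
have ag : agree_off (iota 10 9) s s4.
  apply: agree_off_trans (agree_offW _ ag4) => //.
  apply: agree_off_trans (agree_offW _ ag3) => //.
  apply: agree_off_trans (agree_offW _ ag2) => //.
  exact: agree_off_set.
have r5 := @runs_step (word p) prep2 s4 w0 isT b4.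
exists (step prep2 s4).
  apply: runsW (runs_seq r1 (runs_seq r2 (runs_seq r3 (runs_seq r4 r5)))).
  by rewrite /prep_cost; nia.
have E : step prep2 s4 = set_var (set_var s4 17 (reps p)) 18 (slots p).
  by rewrite /= e11 e14 !ag.1 // v1 v2.
rewrite E; split=> //=.
- by do 2![apply: agree_off_set => //].
- apply: bounded_set_var (slots_lt p); exact: bounded_set_var (reps_lt p).
Qed.

(** * Programs of the users and of the server *)

Definition write_body : cmd :=
  22 ::= $22 [-] #1 ;; CPut 2 ($20 [*] $15 [+] $22) ($23 [%] #2) ;;
  23 ::= $23 [/] #2.
Definition write_bits : cmd := CWhile $22 write_body.

(** Halving produces the bits least significant first, so slot [i] is filled backwards: after [c]
    turns its last [c] cells are final and variable 23 holds [v %/ 2 ^ c]. *)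
Lemma runs_write_bits w s i D v : D < w -> bounded w s ->
  var s 20 = i -> var s 15 = D -> var s 22 = D -> var s 23 = v ->
  exists2 s', runs write_bits s ((unit_cost write_body + 2) * w ^ 2) s' &
    [/\ forall x, x \notin [:: 22; 23] -> var s' x = var s x,
        forall a, a != 2 -> arr s' a = arr s a,
        forall q, arr s' 2 q = if i * D <= q < i * D + D
          then v %/ 2 ^ (i * D + D - 1 - q) %% 2 else arr s 2 q &
        bounded w s'].
Proof.
move=> lt_D bs v20 v15 v22 v23; have w0 : 0 < w by apply: leq_ltn_trans lt_D.
have v_lt : v < 2 ^ w by rewrite -v23; case: bs.
pose I c s' := [/\ var s' 22 = D - c, var s' 23 = v %/ 2 ^ c,
  (forall x, x \notin [:: 22; 23] -> var s' x = var s x)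
    /\ (forall a, a != 2 -> arr s' a = arr s a),
  forall q, arr s' 2 q = if i * D + (D - c) <= q < i * D + D
    then v %/ 2 ^ (i * D + D - 1 - q) %% 2 else arr s 2 q & bounded w s'].
have [|c s' le_c [u22 u23 ag u2 bs']|c s' lt_c [u22 u23 ag u2 bs']||s' r' I'] :=
  @runs_while w $22 write_body (unit_cost write_body * w) D I s.
- exact: w0.
- by split=> //=; rewrite u22; lia.
- have E : step write_body s' = set_var (set_cell (set_var s' 22 (D - c.+1)) 2
      (i * D + (D - c.+1)) (v %/ 2 ^ c %% 2)) 23 (v %/ 2 ^ c.+1).
    rewrite /= u22 u23 !ag.1 // v20 v15 -divnMA -expnSr.
    by rewrite (_ : D - c - 1 = D - c.+1) // -subnDA addn1.
  exists (step write_body s'); first exact: runs_step.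
  rewrite E; case: ag => agv aga; split=> //=.
  + split=> [y|b bN]; last by rewrite (negbTE bN) aga.
    by rewrite !inE negb_or => /andP[/[dup] yN /negbTE-> /[dup] yN' /negbTE->];
      rewrite agv // !inE negb_or yN.
  + move=> q; rewrite u2; case: eqP => [->|neq].
      rewrite (_ : _ && _); last by lia.
      by congr (_ %/ 2 ^ _ %% _); lia.
    by congr (if _ then _ else _); lia.
  + do 2?[apply: bounded_set_var]; last by exact: leq_ltn_trans (leq_div _ _) v_lt.
    apply: bounded_set_cell; first apply: bounded_set_var => //.
      apply: leq_ltn_trans (_ : D < _); first by lia.
      by rewrite (leq_trans lt_D) // ltnW // ltn_expl.
    by apply: leq_ltn_trans v_lt; rewrite (leq_trans (leq_mod _ _)) // leq_div.
- split=> //; first by rewrite subn0.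
    by rewrite divn1.
  by move=> q; rewrite subn0; case: ifP => //; lia.
exists s'; last first.
  case: I' => _ _ [agv aga] u2 bs'; split=> // q.
  by rewrite u2 subnn addn0.
apply: runsW r'; have : D.+1 <= w by [].
rewrite [esize _]/=; move: (unit_cost _) D.+1 => B M; nia.
Qed.

(** Position in the concatenation of the [n * m] sample slots of a round that
    slot [i] probes, when the shared random bits are [u]. *)
Definition probe (p : params) (u : nat -> nat) (r i : nat) : nat :=
  i %/ reps p * 2 ^ blk p
    + bitsval (fun b => u ((r * slots p + i) * blk p + b)) (blk p).

(** Position [pos] is sample number [pos %% pm p] of user [pos %/ pm p]. The shift by one reserves 0
    for having nothing to write. *)
Definition user_value (p : params) (u y : nat -> nat) (r j cnt i : nat) : nat :=
  let pos := probe p u r i in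
  if (pos %/ pm p == j) && (pos %% pm p < cnt) then (y (pos %% pm p)).+1 else 0.

Lemma probe_block p u r i : i < slots p -> (forall q, u q <= 1) ->
  probe p u r i < blocks p * 2 ^ blk p.
Proof.
move=> lt_i u1; have lt_d : i %/ reps p < blocks p by rewrite ltn_divLR ?reps_gt0 // mulnC.
have := bitsval_lt (blk p) (fun b => u1 ((r * slots p + i) * blk p + b)).
by rewrite /probe; nia.
Qed.

Lemma probe_lt p u r i : i < slots p -> (forall q, u q <= 1) ->
  probe p u r i < 2 ^ word p.
Proof.
move=> lt_i u1; apply: (@lt_word p _ 4) => //.
apply: leq_trans (probe_block r lt_i u1) _.
rewrite (expnD _ 2 2) leq_mul ?blocks_base // (@leq_trans (2 ^ word0 p)) //.
  by rewrite leq_exp2l // blk_le.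
by rewrite -{1}(expn1 (2 ^ _)) leq_exp2l // (leq_trans _ (base_ge64 p)).
Qed.

(** Variable 20 is the slot, 21 the bits read and then the probed position, 22 a
    bit counter and 23 the slot value. *)
Definition user_read : cmd := read_bits 1 (($6 [*] $18 [+] $20) [*] $13) 13.
Definition user_pick : cmd :=
  21 ::= $20 [/] $17 [*] $14 [+] $21 ;;
  CIf (($21 [/] $2 [=] $7) [*] ($21 [%] $2 [+] #1 [<=] $8))
    (23 ::= EGet 0 ($21 [%] $2) [+] #1) (23 ::= #0) ;;
  22 ::= $15.
Definition incr20 : cmd := 20 ::= $20 [+] #1.
Definition user : cmd :=
  prep ;; 20 ::= #0 ;;
  CWhile ($20 [+] #1 [<=] $18) (user_read ;; user_pick ;; write_bits ;; incr20).

Definition user_cost : nat :=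
  prep_cost + unit_cost (20 ::= #0) +
  80 * (1005 + unit_cost user_pick + unit_cost write_body + unit_cost incr20 + 20).

(** Arithmetic shared by users and server: [A] and [B] are the costs of preparation and
    initialization, [40 * k * Q] is the number of slots with [k] for [conf] and [Q] for [blocks],
    and [16 * w] pays for the loop guard, of [esize] 4. The bound [k <= w] turns the quadratic cost
    per slot into a cubic total. *)
Lemma loop_cost w k Q A B C X : 0 < w -> 0 < Q -> k <= w -> 17 <= X ->
  A * w ^ 2 + (B * w + (40 * k * Q).+1 * (16 * w + C * w ^ 2).+1).+1
  < (A + B + 80 * (C + X)) * w ^ 3 * Q.
Proof.
move=> w0 Q0 kw X17.
have h1 : (40 * k * Q).+1 <= 41 * (w * Q) by nia.
have h2 : (16 * w + C * w ^ 2).+1 <= (17 + C) * w ^ 2 by nia.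
have h3 := leq_mul h1 h2.
have wQ : 1 <= w * Q by nia.
have h4 : A * w ^ 2 <= A * (w ^ 3 * Q).
  by rewrite (expnSr w 2) -mulnA leq_mul2l leq_pmulr ?orbT.
have h5 : B * w <= B * (w ^ 3 * Q).
  by rewrite (expnS w 2) -mulnA leq_mul2l leq_pmulr ?orbT // muln_gt0 expn_gt0 w0.
have e : 41 * (w * Q) * ((17 + C) * w ^ 2) = 41 * (17 + C) * (w ^ 3 * Q).
  by rewrite (expnS w 2) [RHS]mulnC -!mulnA; nia.
rewrite e in h3.
have h6 : 1 <= w ^ 3 * Q by rewrite muln_gt0 expn_gt0 w0.
rewrite -(mulnA _ (w ^ 3) Q); move: (w ^ 3 * Q) h3 h4 h5 h6 => Z h3 h4 h5 h6.
have h7 : 17 * Z <= X * Z by rewrite leq_mul2r X17 orbT.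
lia.
Qed.

(** The invariant says that after [i] turns the first [i] slots of array 2 are final; each turn only
    writes inside slot [i]. *)
Lemma runs_user p s (u y : nat -> nat) r j cnt :
  has_params p s -> bounded (word p) s ->
  var s 6 = r -> var s 7 = j -> var s 8 = cnt ->
  arr s 0 = y -> arr s 1 = u -> (forall q, y q <= pd p) -> (forall q, u q <= 1) ->
  exists2 s', runs user s (user_cost * word p ^ 3 * blocks p) s' &
    forall q, q < slots p * width p -> arr s' 2 q =
      user_value p u y r j cnt (q %/ width p)
        %/ 2 ^ (width p - 1 - q %% width p) %% 2.
Proof.
move=> hp bs v6 v7 v8 a0 a1 y_le u_le; have w0 := word_gt0 p.
have [s1 r1 [ag1 b1 [e11 e13 e14] [e15 e17 e18]]] := runs_prep hp bs.
have v2 : var s 2 = pm p by rewrite hp.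
have r2 := @runs_step (word p) (20 ::= #0) s1 w0 isT b1.
set val := user_value p u y r j cnt; set D := width p.
pose I i s' := [/\ var s' 20 = i,
  forall x, x \notin iota 20 4 -> var s' x = var s1 x,
  forall a, a != 2 -> arr s' a = arr s1 a,
  forall q, q < i * D -> arr s' 2 q = val (q %/ D) %/ 2 ^ (D - 1 - q %% D) %% 2 &
  bounded (word p) s'].
set body := user_read ;; user_pick ;; write_bits ;; incr20.
have small i : i <= slots p -> i < 2 ^ word p.
  by move=> le_i; apply: leq_ltn_trans le_i (slots_lt p).
have [|i s' le_i [u20 agv aga u2 bs']|i s' lt_i [u20 agv aga u2 bs']||s' r' I'] :=
  @runs_while (word p) ($20 [+] #1 [<=] $18) body
    ((1005 + unit_cost user_pick + unit_cost write_body + unit_cost incr20)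
      * word p ^ 2) (slots p) I (step (20 ::= #0) s1).
- exact: w0.
- by split=> //=; rewrite u20 agv // e18 addn1; case: (i < _).
- have [||||||s3 r3 [e21 ag3 b3]] := @runs_read_bits 1
    (($6 [*] $18 [+] $20) [*] $13) 13 (word p) s'; rewrite -/user_read.
  + by [].
  + by [].
  + by rewrite agv // e13 blk_lt.
  + by [].
  + by move=> q; rewrite aga // ag1.2 a1.
  + by move=> s3 [/= agv3 _]; rewrite !agv3.
  have {}e21 : i %/ reps p * 2 ^ blk p + var s3 21 = probe p u r i.
    by rewrite e21 /= u20 (agv 6) // (agv 13) // (agv 18) // aga // e13 e18 ag1.2 a1
      ag1.1 // v6.
  have ag13 x : x \notin iota 20 4 -> var s3 x = var s1 x.
    move=> xN; rewrite ag3.1 ?agv //; move: xN.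
    by rewrite !inE !negb_or => /and4P[_ -> ->].
  have r4 := @runs_step (word p) user_pick s3 w0 isT b3.
  have E : step user_pick s3 = set_var (set_var
      (set_var s3 21 (probe p u r i)) 23 (val i)) 22 D.
    rewrite /= (ag3.1 20) // u20 (ag13 17) // (ag13 14) // (ag13 2) // (ag13 7) //.
    rewrite (ag13 8) // e17 e14 e21 !ag1.1 // v2 v7 v8 /val /user_value /= addn1.
    have e15' : var s3 15 = D by rewrite ag13.
    have e0 : arr s3 0 = y by rewrite ag3.2 aga // ag1.2.
    by rewrite mulnb eqb0 negbK; case: ifP => _ /=; rewrite e15' ?e0 ?addn1.
  have b4 : bounded (word p) (step user_pick s3).
    rewrite E; do 3?[apply: bounded_set_var => //].
    + exact: probe_lt.
    + rewrite /val /user_value; case: ifP => _; last by rewrite expn_gt0.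
      apply: leq_ltn_trans (_ : (pd p).+1 < _); first by rewrite ltnS.
      by apply: param_lt_word; rewrite !inE eqxx !orbT.
    + exact: leq_trans (width_lt p) (ltnW (ltn_expl _ (isT : 1 < 2))).
  have [||||||s5 r5 [agv5 aga5 a52 b5]] :=
    @runs_write_bits (word p) (step user_pick s3) i D (val i).
  + exact: width_lt.
  + exact: b4.
  + by rewrite E /= ag3.1.
  + by rewrite E /= ag3.1 // agv.
  + by rewrite E.
  + by rewrite E.
  have r6 := @runs_step (word p) incr20 s5 w0 isT b5.
  have E6 : step incr20 s5 = set_var s5 20 i.+1.
    by rewrite /= agv5 // E /= ag3.1 // u20 addn1.
  exists (step incr20 s5).
    apply: runsW (runs_seq r3 (runs_seq r4 (runs_seq r5 r6))).
    by clear -w0; nia.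
  rewrite E6; split=> //=.
  + move=> x xN.
    have [x0 [x1 [x2 x3]]] : x != 20 /\ x != 21 /\ x != 22 /\ x != 23.
      by move: xN; rewrite !inE !negb_or => /and4P[].
    rewrite (negbTE x0) agv5 ?inE ?negb_or ?x2 // E /=.
    by rewrite (negbTE x1) (negbTE x2) (negbTE x3) ag3.1 ?agv // !inE negb_or x1.
  + by move=> a aN; rewrite aga5 // E /= ag3.2 aga.
  + move=> q lt_q; rewrite a52; have D0 : 0 < D := width_gt0 p.
    case: ifP => [/andP[le_q lt_q']|nlt].
      have -> : q = i * D + (q - i * D) by rewrite subnKC.
      have lt_qD : q - i * D < D by lia.
      rewrite divnMDl // modnMDl (divn_small lt_qD) (modn_small lt_qD) addn0.
      by congr (_ %/ 2 ^ _ %% _); lia.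
    have lt_qi : q < i * D by move: lt_q nlt; rewrite mulSn; lia.
    by rewrite E /= ag3.2 u2.
  + by apply: bounded_set_var => //; apply: small.
- split=> //=.
  + by move=> x; rewrite !inE !negb_or => /and4P[/negbTE->].
  + by apply: bounded_set_var; rewrite ?expn_gt0.
exists s'; last by case: I'.
apply: runsW (runs_seq r1 (runs_seq r2 r')).
have Q0 : 0 < blocks p by rewrite /blocks addn1.
have := @loop_cost (word p) (conf p) (blocks p) prep_cost (unit_cost (20 ::= #0))
  (1005 + unit_cost user_pick + unit_cost write_body + unit_cost incr20) 20 w0 Q0
  (ltnW (conf_lt p)) isT.
by apply: leq_trans.
Qed.

Definition slot_value (p : params) (y : nat -> nat) (i : nat) : nat :=
  bitsval (fun b => y (i * width p + b)) (width p).

Definition threshold (p : params) : nat := 8 * conf p.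

(** Array 3 counts the occurrences of every valid slot value [x + 1] among the
    values [vs] received so far, and the output lists the [x] whose count has
    reached the threshold. *)
Definition tallied (p : params) (vs : seq nat) (s : state) : Prop :=
  [/\ forall v, 0 < v <= pd p -> arr s 3 v = count_mem v vs,
      mkseq (arr s 2) (var s 7) =i
        [pred x | (x < pd p) && (threshold p <= count_mem x.+1 vs)] &
      var s 7 <= size vs].

Definition server_read : cmd := read_bits 0 ($20 [*] $15) 15.
Definition server_count : cmd :=
  CIf ((#1 [<=] $21) [*] ($21 [<=] $3))
    (CPut 3 $21 (EGet 3 $21 [+] #1) ;;
     CIf (EGet 3 $21 [=] #8 [*] $11)
       (CPut 2 $7 ($21 [-] #1) ;; 7 ::= $7 [+] #1) CSkip)
    CSkip ;;
  20 ::= $20 [+] #1.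
Definition server : cmd :=
  prep ;; 20 ::= #0 ;;
  CWhile ($20 [+] #1 [<=] $18) (server_read ;; server_count).

Definition server_cost : nat :=
  prep_cost + unit_cost (20 ::= #0) + 80 * (1001 + unit_cost server_count + 20).

Lemma mkseq_snoc (T : Type) (f : nat -> T) k y :
  mkseq (fun i => if i == k then y else f i) k.+1 = rcons (mkseq f k) y.
Proof.
rewrite mkseqS eqxx; congr rcons; apply/eq_in_map => i.
by rewrite mem_iota => /= lt_i; rewrite ltn_eqF.
Qed.

(** Counts grow by one, so the program can test for equality with the threshold: a value is appended
    to the output exactly when its count first gets there, and later occurrences leave the list
    alone. *)
Lemma tallied_step p vs s v i : has_params p s -> var s 11 = conf p ->
  bounded (word p) s -> (size vs).+1 < 2 ^ word p ->
  var s 21 = v -> var s 20 = i -> i.+1 < 2 ^ word p -> tallied p vs s ->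
  let s' := step server_count s in
  [/\ tallied p (rcons vs v) s', bounded (word p) s', var s' 20 = i.+1,
      forall x, x != 7 -> x != 20 -> var s' x = var s x & arr s' 0 = arr s 0].
Proof.
move=> hp v11 bs lt_vs v21 v20 lt_i [cnt out len] /=.
have v3 : var s 3 = pd p by rewrite hp.
have le_cnt x : count_mem x vs < 2 ^ word p.
  by rewrite (leq_ltn_trans (count_size _ _)) // ltnW.
have cnt_rcons x : count_mem x (rcons vs v) = count_mem x vs + (x == v).
  by rewrite -cats1 count_cat /= addn0 eq_sym.
rewrite v21 v3 mulnb eqb0 negbK; case: ifP => [valid|invalid]; last first.
  rewrite /= v20 addn1; split=> //=.
  - split=> //= [x x_ok|x|]; last by rewrite size_rcons leqW.
      rewrite cnt_rcons cnt //; case: eqP x_ok => [->|_ _]; last by rewrite addn0.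
      by rewrite invalid.
    rewrite out !inE cnt_rcons; case: (ltnP x (pd p)) => //= lt_x.
    by case: eqP => [eq_v|_]; rewrite ?addn0 //; rewrite -eq_v lt_x in invalid.
  - by apply: bounded_set_var.
  - by move=> x _ /negbTE ->.
have v_gt0 : 0 < v by case/andP: valid.
have v_le : v <= pd p by case/andP: valid.
rewrite v11 cnt // addn1 eqxx.
have b1 : bounded (word p) (set_cell s 3 v (count_mem v vs).+1).
  apply: bounded_set_cell => //; apply: leq_ltn_trans lt_vs.
  by rewrite ltnS count_size.
have cnt' x : 0 < x <= pd p -> (if x == v then (count_mem v vs).+1 else arr s 3 x)
    = count_mem x (rcons vs v).
  by move=> x_ok; rewrite cnt_rcons; case: eqP => [->|_]; rewrite ?addn1 ?addn0 ?cnt.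
have thr0 : 0 < threshold p by rewrite /threshold muln_gt0.
rewrite -/(threshold p) eqb0 negbK; case: eqP => [eq_thr|ne_thr] /=.
  rewrite v20 !addn1 subn1; split=> //=.
  - split=> //= [x|]; last by rewrite size_rcons ltnS.
    rewrite mkseq_snoc mem_rcons !inE out !inE cnt_rcons.
    have -> : (x == v.-1) = (x.+1 == v) by case: (v) v_gt0.
    case: (eqVneq x.+1 v) => [eq_v|_] /=; last by rewrite addn0.
    by rewrite eq_v v_le addn1 eq_thr leqnn.
  - do 2?[apply: bounded_set_var => //]; last first.
      by apply: leq_ltn_trans lt_vs; rewrite ltnS.
    apply: bounded_set_cell => //; apply: (@leq_ltn_trans (pd p).+1).
      by rewrite (leq_trans (leq_pred _)) // ltnW.
    by apply: param_lt_word; rewrite !inE eqxx !orbT.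
  - by move=> x /negbTE -> /negbTE ->.
(* The new count differs from the threshold, so the old and the new count compare with it in the
   same way. *)
rewrite v20 addn1; split=> //=.
- split=> //= [x|]; last by rewrite size_rcons leqW.
  rewrite out !inE cnt_rcons; congr (_ && _).
  case: eqP => [eq_v|_]; last by rewrite addn0.
  by rewrite eq_v; move: ne_thr; move: (threshold p) (count_mem v vs) => a b; lia.
- by apply: bounded_set_var.
- by move=> x _ /negbTE ->.
Qed.

(** [prep] is repeated in every round but only touches variables 10 to 18, so the parameters, the
    output length in variable 7 and the tally in array 3 survive from one round to the next. *)
Lemma runs_server p s (y : nat -> nat) vs :
  has_params p s -> bounded (word p) s -> arr s 0 = y -> (forall q, y q <= 1) ->
  size vs + slots p < 2 ^ word p -> tallied p vs s ->
  exists2 s', runs server s (server_cost * word p ^ 3 * blocks p) s' &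
    [/\ has_params p s', bounded (word p) s' &
        tallied p (vs ++ [seq slot_value p y i | i <- iota 0 (slots p)]) s'].
Proof.
move=> hp bs a0 y_le lt_vs tal; have w0 := word_gt0 p.
have [s1 r1 [ag1 b1 [e11 e13 e14] [e15 e17 e18]]] := runs_prep hp bs.
have r2 := @runs_step (word p) (20 ::= #0) s1 w0 isT b1.
pose I i s' := [/\ var s' 20 = i, arr s' 0 = y,
  forall x, x \notin 7 :: iota 20 3 -> var s' x = var s1 x,
  tallied p (vs ++ [seq slot_value p y i | i <- iota 0 i]) s' &
  bounded (word p) s'].
set body := server_read ;; server_count.
have small i : i <= slots p -> i < 2 ^ word p.
  by move=> le_i; apply: leq_ltn_trans le_i (slots_lt p).
have hp1 x : x < 6 -> var s1 x = nth 0 (param_seq p) x.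
  move=> lt_x; rewrite ag1.1 ?hp //.
  by rewrite mem_iota; lia.
have hpx s' : (forall x, x \notin 7 :: iota 20 3 -> var s' x = var s1 x) -> has_params p s'.
  move=> agv x lt_x; rewrite agv ?hp1 //.
  by rewrite in_cons mem_iota; lia.
have [|i s' le_i [u20 ua0 agv tal' bs']|i s' lt_i [u20 ua0 agv tal' bs']||s' r' I'] :=
  @runs_while (word p) ($20 [+] #1 [<=] $18) body
    ((1001 + unit_cost server_count) * word p ^ 2) (slots p) I (step (20 ::= #0) s1).
- exact: w0.
- by split=> //=; rewrite u20 agv // e18 addn1; case: (i < _).
- have [||||||s3 r3 [e21 ag3 b3]] := @runs_read_bits 0 ($20 [*] $15) 15 (word p) s';
    rewrite -/server_read.
  + by [].
  + by [].
  + by rewrite agv // e15 width_lt.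
  + by [].
  + by move=> q; rewrite ua0.
  + by move=> s3 [/= agv3 _]; rewrite !agv3.
  have {}e21 : var s3 21 = slot_value p y i.
    by rewrite e21 /= u20 (agv 15) // ua0 e15.
  have ag13 x : x \notin 7 :: iota 20 3 -> var s3 x = var s1 x.
    move=> xN; rewrite ag3.1 ?agv //; move: xN.
    by rewrite !inE !negb_or => /and4P[_ _ -> ->].
  have sz : size (vs ++ [seq slot_value p y i | i <- iota 0 i]) = size vs + i.
    by rewrite size_cat size_map size_iota.
  have [||||||tal4 b4 w20 agv4 a40] := @tallied_step p
    (vs ++ [seq slot_value p y i | i <- iota 0 i]) s3 (slot_value p y i) i _ _ b3 _ e21.
  + exact: hpx.
  + by rewrite ag13.
  + rewrite sz; apply: leq_ltn_trans lt_vs; rewrite -addnS leq_add2l //.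
  + by rewrite ag3.1.
  + exact: small.
  + case: tal' => t1 t2 t3; split; first by move=> v; rewrite ag3.2; apply: t1.
      by rewrite ag3.2 ag3.1.
    by rewrite ag3.1.
  exists (step server_count s3).
    apply: runsW (runs_seq r3 (@runs_step (word p) server_count s3 w0 isT b3)).
    by clear -w0; nia.
  split=> //.
  + by rewrite a40 ag3.2.
  + move=> x xN; rewrite agv4 ?ag13 //.
      by apply: contra xN => /eqP->.
    by apply: contra xN => /eqP->.
  + by rewrite -addn1 iotaD map_cat catA cats1.
- split=> //=.
  + by rewrite ag1.2.
  + by move=> x; rewrite !inE !negb_or => /and4P[_ /negbTE->].
  + case: tal => t1 t2 t3; rewrite cats0; split; first by move=> v; rewrite /= ag1.2; apply: t1.
      by rewrite /= ag1.2 ag1.1.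
    by rewrite /= ag1.1.
  + by apply: bounded_set_var; rewrite ?expn_gt0.
exists s'; last by case: I' => _ _ agv tal' b'; split=> //; apply: hpx.
apply: runsW (runs_seq r1 (runs_seq r2 r')).
have Q0 : 0 < blocks p by rewrite /blocks addn1.
have := @loop_cost (word p) (conf p) (blocks p) prep_cost (unit_cost (20 ::= #0))
  (1001 + unit_cost server_count) 20 w0 Q0 (ltnW (conf_lt p)) isT.
by apply: leq_trans.
Qed.

(** * Tail bounds for hits of independent uniform bit blocks *)

Local Open Scope ring_scope.

Lemma eq_bitsval f g k : (forall i, (i < k)%N -> f i = g i) -> bitsval f k = bitsval g k.
Proof.
move=> efg; rewrite /bitsval; congr foldl.
by apply/eq_in_map => i; rewrite mem_iota; apply: efg.
Qed.

Lemma big_ord_mul (V : nmodType) (a b : nat) (f : nat -> V) :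
  \sum_(g < a * b) f g = \sum_(i < a) \sum_(j < b) f (i * b + j)%N.
Proof.
elim: a => [|a IHa]; first by rewrite !big_ord0.
by rewrite big_ord_recr /= -IHa mulSnr big_split_ord /=.
Qed.

Section SumBits.
Variable F : realType.
Implicit Types (G : seq bool -> F).

(** Recursion on the length lets sums over bit strings split along concatenation without casts
    between tuple types. *)
Fixpoint sum_bits (k : nat) G : F :=
  match k with
  | 0 => G [::]
  | k'.+1 => sum_bits k' (fun u => G (true :: u)) + sum_bits k' (fun u => G (false :: u))
  end.

Lemma sum_tuple_bits k G : \sum_(U : k.-tuple bool) G (tval U) = sum_bits k G.
Proof.
elim: k G => [|k IHk] G /=.
  by rewrite (big_pred1 [tuple]) // => U; apply/esym/eqP/tuple0.
rewrite -!IHk.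
transitivity (\sum_b \sum_(u : k.-tuple bool) G (b :: u)); last by rewrite big_bool.
rewrite pair_bigA /=.
rewrite (reindex (fun bu : bool * k.-tuple bool => cons_tuple bu.1 bu.2)) //=.
apply: onW_bij; exists (fun U : k.+1.-tuple bool => (thead U, behead_tuple U)).
  by move=> [b u] /=; congr pair; apply: val_inj.
by move=> U; rewrite [RHS]tuple_eta; apply: val_inj.
Qed.

Lemma eq_sum_bits k G H :
  (forall u, size u = k -> G u = H u) -> sum_bits k G = sum_bits k H.
Proof.
elim: k G H => [|k IHk] G H eGH /=; first exact: eGH.
by congr (_ + _); apply: IHk => u su; apply: eGH; rewrite /= su.
Qed.

Lemma sum_bits_cat a b G :
  sum_bits (a + b) G = sum_bits a (fun u => sum_bits b (fun v => G (u ++ v))).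
Proof. by elim: a G => //= a IHa G; rewrite !IHa. Qed.

Lemma sum_bitsZl k c G : sum_bits k (fun u => c * G u) = c * sum_bits k G.
Proof. by elim: k G => //= k IHk G; rewrite !IHk mulrDr. Qed.

(** Uniform bits read as a binary number give a uniform number; the accumulator [a] is there for the
    induction. *)
Lemma sum_bits_foldl t a (f : nat -> F) :
  sum_bits t (fun u => f (foldl (fun v b => v.*2 + b)%N a (map nat_of_bool u)))
  = \sum_(v < 2 ^ t) f (a * 2 ^ t + v)%N.
Proof.
elim: t a => [|t IHt] a /=; first by rewrite big_ord1 muln1 addn0.
have -> : (2 ^ t.+1 = 2 ^ t + 2 ^ t)%N by rewrite expnS mul2n addnn.
rewrite !IHt big_split_ord /= addrC.
by congr (_ + _); apply: eq_bigr => v _; congr f; rewrite -muln2; nia.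
Qed.

(** Independence of disjoint bit blocks, obtained by peeling off the first block. *)
Lemma sum_bits_prod k t (f : nat -> nat -> F) :
  sum_bits (k * t) (fun u => \prod_(g < k) f g
    (bitsval (fun b => nth 0%N (map nat_of_bool u) (g * t + b)) t))
  = \prod_(g < k) \sum_(v < 2 ^ t) f g v.
Proof.
elim: k f => [|k IHk] f; first by rewrite mul0n /= !big_ord0.
rewrite mulSn sum_bits_cat big_ord_recl -(sum_bits_foldl t 0).
have -> : \prod_(g < k) \sum_(v < 2 ^ t) f (lift ord0 g) v =
    \prod_(g < k) \sum_(v < 2 ^ t) f g.+1 v by [].
rewrite -(IHk (fun g => f g.+1)) [RHS]mulrC -sum_bitsZl.
apply: eq_sum_bits => u su; rewrite [RHS]mulrC -sum_bitsZl.
apply: eq_sum_bits => v sv; rewrite big_ord_recl; congr (f _ _ * _).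
  rewrite (@eq_bitsval _ (nth 0%N (map nat_of_bool u))); last first.
    by move=> b lt_b; rewrite map_cat nth_cat size_map su lt_b.
  by rewrite -{1}su -(size_map nat_of_bool) /bitsval mkseq_nth.
apply: eq_bigr => g _; congr f; apply: eq_bitsval => b lt_b.
rewrite map_cat nth_cat size_map su /= /bump add1n mulSn.
by rewrite -addnA ltnNge leq_addr /= addKn.
Qed.
End SumBits.
Definition chunk (t : nat) (u : nat -> nat) (g : nat) : nat :=
  bitsval (fun b => u (g * t + b)%N) t.

Definition bit_fun (u : seq bool) : nat -> nat := nth 0%N (map nat_of_bool u).

Section Chernoff.
Variables (F : realType) (k t : nat) (hit : nat -> nat -> bool).

Let hits (u : seq bool) : nat := (\sum_(g < k) hit g (chunk t (bit_fun u) g))%N.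
Let total : nat := (\sum_(g < k) \sum_(v < 2 ^ t) hit g v)%N.
(** The expectation of [hits], since each chunk is uniform below [2 ^ t]. *)
Let mean : F := total%:R / 2 ^+ t.

(** Moment generating function in unnormalized form: by independence it is a product of factors
    [1 + (a - 1) q] with [q] the hit probability, and [1 + x <= expR x] bounds each of them. *)
Lemma sum_exp_hits (a : F) : 0 <= a ->
  \sum_(U : (k * t).-tuple bool) a ^+ hits U <= 2 ^+ (k * t) * expR ((a - 1) * mean).
Proof.
move=> a0.
have -> : \sum_(U : (k * t).-tuple bool) a ^+ hits U =
    \prod_(g < k) \sum_(v < 2 ^ t) a ^+ hit g v.
  rewrite -(sum_bits_prod k t (fun g v => a ^+ hit g v)) -sum_tuple_bits.
  by apply: eq_bigr => U _; rewrite -prodrXr.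
apply: (@le_trans _ _ (\prod_(g < k)
    (2 ^+ t * expR ((a - 1) * ((\sum_(v < 2 ^ t) hit g v)%N%:R / 2 ^+ t))))).
  apply: ler_prod => g _; apply/andP; split.
    by apply: sumr_ge0 => v _; rewrite exprn_ge0.
  have -> : \sum_(v < 2 ^ t) a ^+ hit g v =
      2 ^+ t * (1 + (a - 1) * ((\sum_(v < 2 ^ t) hit g v)%N%:R / 2 ^+ t)).
    rewrite mulrDr mulr1 mulrCA [X in _ + _ * X]mulrC divfK; last first.
      by rewrite expf_neq0 // pnatr_eq0.
    rewrite natr_sum mulr_sumr -natrX -[X in X%:R]card_ord -sumr_const -big_split /=.
    apply: eq_bigr => v _; case: (hit g v); rewrite /= ?mulr0 ?addr0 //.
    by rewrite mulr1 addrC subrK.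
  by rewrite ler_pM2l ?exprn_gt0 ?ltr0n // expR_ge1Dx.
rewrite big_split /= prodr_const card_ord -exprM mulnC.
by rewrite /mean /total natr_sum mulr_suml mulr_sumr expR_sum.
Qed.

(** Markov's inequality in counting form. *)
Lemma markov_card (K : nat) (w : K.-tuple bool -> F) (P : pred (K.-tuple bool)) (x : F) :
  (forall U, 0 <= w U) -> (forall U, P U -> x <= w U) ->
  #|[pred U | P U]|%:R * x <= \sum_U w U.
Proof.
move=> w0 wP; rewrite mulr_natl -sumr_const [leRHS](bigID P) /=.
apply: (@le_trans _ _ (\sum_(U | P U) w U)); last first.
  by rewrite lerDl sumr_ge0.
exact: ler_sum.
Qed.

(** Take [a = 2]: the event has weight at least [2 ^ (8 c)], while the average weight is at most
    [exp (4 c) <= 2 ^ (7 c)]. *)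
Lemma card_hits_ge (c : nat) : mean <= 4 * c%:R ->
  #|[pred U : (k * t).-tuple bool | (8 * c <= hits U)%N]|%:R * 2 ^+ c
    <= 2 ^+ (k * t) :> F.
Proof.
move=> le_mean.
(* From [1 - 1/4 <= exp (- 1/4)] one gets [exp (1/4) <= 4/3], and the 16th power of [4/3] is below
   128. *)
have e4 : expR 4 <= 2 ^+ 7 :> F.
  have -> : 4 = 16%:R * 4^-1 :> F by lra.
  rewrite expRM_natl.
  have h : expR 4^-1 <= 4 / 3 :> F.
    rewrite -[expR _]invrK -expRN -[4 / 3]invf_div.
    have h34 : 3 / 4 <= expR (- 4^-1) :> F by apply: le_trans (expR_ge1Dx _); lra.
    by rewrite lef_pV2 ?posrE ?expR_gt0 //; lra.
  apply: le_trans (_ : (4 / 3) ^+ 16 <= _); last by lra.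
  by rewrite lerXn2r // nnegrE ?expR_ge0 //; lra.
have := @markov_card _ (fun U => 2 ^+ hits U)
  (fun U : (k * t).-tuple bool => (8 * c <= hits U)%N) (2 ^+ (8 * c)).
move=> /(_ (fun U => exprn_ge0 _ (ler0n _ _))) /(_ _)/wrap[].
  by move=> U le_h; rewrite ler_weXn2l // ler1n.
move=> /le_trans/(_ (sum_exp_hits (ler0n _ _))).
have -> : 2 - 1 = 1 :> F by lra.
rewrite mul1r => le1.
have le2 : expR mean <= 2 ^+ (7 * c) :> F.
  rewrite exprM; apply: le_trans (_ : expR (c%:R * 4) <= _).
    by rewrite ler_expR mulrC.
  by rewrite expRM_natl lerXn2r // nnegrE ?expR_ge0 // exprn_ge0.
rewrite -(@ler_pM2r _ (2 ^+ (7 * c))) ?exprn_gt0 // -mulrA -exprD.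
have -> : (c + 7 * c = 8 * c)%N by lia.
apply: le_trans le1 _.
by rewrite ler_pM2l ?exprn_gt0.
Qed.

(** Take [a = 1/2]: the event has weight at least [2 ^ (- 8 c)], while the average weight is at most
    [exp (- 10 c) <= 2 ^ (- 10 c)]. *)
Lemma card_hits_lt (c : nat) : 20 * c%:R <= mean ->
  #|[pred U : (k * t).-tuple bool | (hits U < 8 * c)%N]|%:R * 2 ^+ c
    <= 2 ^+ (k * t) :> F.
Proof.
move=> le_mean.
have e10 : 2 ^+ 10 <= expR 10 :> F.
  have -> : 10 = 10%:R * 1 :> F by lra.
  rewrite expRM_natl lerXn2r // ?nnegrE ?expR_ge0 //.
  by apply: le_trans (expR_ge1Dx _); lra.
have := @markov_card _ (fun U => 2^-1 ^+ hits U)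
  (fun U : (k * t).-tuple bool => (hits U < 8 * c)%N) (2^-1 ^+ (8 * c)).
have half0 : 0 <= 2^-1 :> F by lra.
move=> /(_ (fun U => exprn_ge0 _ half0)) /(_ _)/wrap[].
  by move=> U lt_h; rewrite ler_wiXn2l // 1?ltnW //; lra.
move=> /le_trans/(_ (sum_exp_hits half0)).
have -> : (2^-1 - 1) * mean = - (mean / 2) by lra.
rewrite expRN => le1.
have le2 : 2 ^+ (10 * c) <= expR (mean / 2) :> F.
  rewrite exprM; apply: le_trans (_ : _ <= expR (c%:R * 10)) _.
    by rewrite expRM_natl lerXn2r // nnegrE ?expR_ge0 // exprn_ge0.
  by rewrite ler_expR; lra.
have {le2}le2 : (expR (mean / 2))^-1 <= (2 ^+ (10 * c))^-1.
  by rewrite lef_pV2 ?posrE ?expR_gt0 ?exprn_gt0.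
have {}le1 : #|[pred U : (k * t).-tuple bool | (hits U < 8 * c)%N]|%:R * 2^-1 ^+ (8 * c)
    <= 2 ^+ (k * t) * (2 ^+ (10 * c))^-1 :> F.
  by apply: le_trans le1 _; rewrite ler_pM2l ?exprn_gt0.
(* The estimate gains [2 ^ (- 2 c)]; the second factor [2 ^ c] is given up at the end. *)
have e : (10 * c = 8 * c + c + c)%N by lia.
rewrite exprVn ler_pdivlMr ?exprn_gt0 // e 2!exprD -!mulrA in le1.
rewrite mulKf ?expf_neq0 ?pnatr_eq0 // mulrA in le1.
by apply: le_trans le1; rewrite ler_peMr ?exprn_ege1 ?ler1n //.
Qed.
End Chernoff.

(** * The protocol *)

Local Open Scope nat_scope.

Lemma count_samples d (h : hist d) (a : pred nat) :
  count a (samples h) = \sum_(x < d) a (val x) * h x.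
Proof.
rewrite /samples count_flatten sumnE 2!big_map big_enum /=.
by apply: eq_bigr => x _; rewrite count_nseq.
Qed.

Lemma size_samples d (h : hist d) : size (samples h) = norm1 h.
Proof.
by rewrite -count_predT count_samples; apply: eq_bigr => x _; rewrite mul1n.
Qed.

Lemma count_mem_samples d (h : hist d) (x : 'I_d) : count_mem (val x) (samples h) = h x.
Proof.
rewrite count_samples (bigD1 x) //= eqxx mul1n big1 ?addn0 // => y.
by rewrite -val_eqE /= => /negbTE->.
Qed.

Lemma nth_samples_lt d (h : hist d) i : i < norm1 h -> nth 0 (samples h) i < d.
Proof.
rewrite -size_samples => /(mem_nth 0) /flatten_mapP[x _].
rewrite mem_nseq => /andP[_ /eqP->]; exact: ltn_ord.
Qed.

Lemma nth_samples_le d (h : hist d) i : nth 0 (samples h) i <= d.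
Proof.
case: (ltnP i (norm1 h)) => [/nth_samples_lt/ltnW //|].
by rewrite -size_samples => /(nth_default 0)->.
Qed.

Lemma sum_nth_count (s : seq nat) (m x : nat) : size s <= m ->
  \sum_(i < m) ((i < size s) && (nth 0 s i == x)) = count_mem x s.
Proof.
move=> /subnKC<-; rewrite big_split_ord /= [X in _ + X]big1 ?addn0; last first.
  by move=> i _; rewrite ltnNge leq_addr.
rewrite -sum1_count (big_nth 0) big_mkord [RHS]big_mkcond /=.
by apply: eq_bigr => i _; rewrite ltn_ord; case: eqP.
Qed.

(** Decoding inverts the bitwise encoding: the first [c] bits read so far form
    [v %/ 2 ^ (k - c)]. *)
Lemma bitsval_odd v k : v < 2 ^ k ->
  bitsval (fun b => odd (v %/ 2 ^ (k - 1 - b))) k = v.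
Proof.
move=> lt_v; suff H c : c <= k ->
    bitsval (fun b => odd (v %/ 2 ^ (k - 1 - b))) c = v %/ 2 ^ (k - c).
  by rewrite H // subnn divn1.
elim: c => [_|c IHc lt_c]; first by rewrite subn0 divn_small.
have e1 : k - 1 - c = k - c.+1 by rewrite -subnDA add1n.
have e2 : k - c = (k - c.+1).+1 by rewrite -subSn.
rewrite bitsvalS (IHc (ltnW lt_c)) e1 e2.
by rewrite expnSr divnMA divn2 addnC odd_double_half.
Qed.

(** Addition is bitwise exclusive or, so messages with disjoint supports are
    merged without carries. *)
Definition bits_ring (l : nat) : finPzRingType :=
  HB.pack {ffun 'I_l -> bool} (Finite.on {ffun 'I_l -> bool})
    (GRing.PzRing.on {ffun 'I_l -> bool}).

Definition bits_of (l : nat) (f : bits_ring l) : l.-tuple bool :=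
  [tuple (f : {ffun 'I_l -> bool}) i | i < l].

Lemma bits_of_inj l : injective (@bits_of l).
Proof.
move=> f g /(congr1 (fun t => tnth t)) e; apply/ffunP => i.
by have := congr1 (fun F => F i) e; rewrite !tnth_mktuple.
Qed.

Lemma sum_bits_ringE l (I : finType) (F : I -> bits_ring l) (q : 'I_l) :
  ((\sum_(j : I) F j)%R : {ffun 'I_l -> bool}) q =
  \big[addb/false]_j (F j : {ffun 'I_l -> bool}) q.
Proof.
apply: (big_morph (fun f : bits_ring l => (f : {ffun 'I_l -> bool}) q)) => [f g|].
  by rewrite ffunE.
by rewrite ffunE.
Qed.

Section Protocol.
Variable p : params.
Notation R := (pR p).
Notation n := (pn p).
Notation m := (pm p).
Notation d := (pd p).

Definition message_bits (r : 'I_R) (j : 'I_n) (h : hist d)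
    (U : (R * slots p * blk p).-tuple bool) : bits_ring (slots p * width p) :=
  [ffun q : 'I_(slots p * width p) =>
    odd (user_value p (bit_fun U) (nth 0 (samples h)) r j (norm1 h) (q %/ width p)
      %/ 2 ^ (width p - 1 - q %% width p))].

Definition slot_values (y : seq bool) : seq nat :=
  [seq slot_value p (bit_fun y) i | i <- iota 0 (slots p)].

Definition heavy_answer (Y : 'I_R -> bits_ring (slots p * width p))
    (U : (R * slots p * blk p).-tuple bool) : {set 'I_d} :=
  [set x : 'I_d | threshold p <=
    count_mem (val x).+1 (flatten [seq slot_values (bits_of (Y r)) | r <- enum 'I_R])].

Definition protocol : ni_protocol R n d (slots p * width p) (R * slots p * blk p) :=
  @NIProtocol R n d (slots p * width p) (R * slots p * blk p)
    (fun=> bits_ring (slots p * width p)) (fun=> @bits_of _)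
    (fun=> @bits_of_inj _) message_bits heavy_answer.

Section Received.
Variable h : dataset R n d.
Hypothesis h_m : at_most_samples m h.

(** The slot value that results from probing [pos]; [insub] finds the owner, and a position without
    owner yields 0. *)
Definition received (r : 'I_R) (pos : nat) : nat :=
  if insub (pos %/ m) is Some j then
    if pos %% m < norm1 (h r j) then (nth 0 (samples (h r j)) (pos %% m)).+1 else 0
  else 0.

Lemma received_le r pos : received r pos <= d.
Proof.
rewrite /received; case: insub => // j; case: ifP => // lt_pos.
exact: nth_samples_lt.
Qed.

(** Only the owner of the probed position can write a nonzero value, so the exclusive or has at most
    one nonzero term. *)
Lemma round_sumE (U : (R * slots p * blk p).-tuple bool) (r : 'I_R)
    (q : 'I_(slots p * width p)) :
  (round_sum protocol h U r : {ffun 'I_(slots p * width p) -> bool}) q =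
  odd (received r (probe p (bit_fun U) r (q %/ width p))
    %/ 2 ^ (width p - 1 - q %% width p)).
Proof.
rewrite /round_sum sum_bits_ringE /=.
under eq_bigr => j _ do rewrite ffunE /user_value.
rewrite /received; case: insubP => [j _ ej|nlt].
  rewrite (bigD1 j) //= big1 ?addbF; last first.
    move=> j' ne; rewrite -ej; case: eqP => [/val_inj e|_] /=.
      by rewrite e eqxx in ne.
    by rewrite div0n.
  by rewrite -ej eqxx.
rewrite big1 ?div0n // => j _; case: eqP => [e|_] /=; last by rewrite div0n.
by rewrite e ltn_ord in nlt.
Qed.

Lemma slot_value_received U (r : 'I_R) i : i < slots p ->
  slot_value p (bit_fun (encode protocol (round_sum protocol h U r))) i =
  received r (probe p (bit_fun U) r i).
Proof.
move=> lt_i; rewrite -[RHS](@bitsval_odd _ (width p)); last first.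
  exact: leq_ltn_trans (received_le _ _) (ltn_bitlen _).
apply: eq_bitsval => b lt_b.
have lt_q : i * width p + b < slots p * width p by nia.
rewrite /bit_fun (nth_map false) ?size_tuple //.
rewrite -[i * width p + b]/(val (Ordinal lt_q)) -tnth_nth tnth_mktuple round_sumE /=.
by rewrite divnMDl ?width_gt0 // modnMDl (divn_small lt_b) (modn_small lt_b) addn0.
Qed.

(** The probes of all rounds are numbered consecutively by [g], and [v] is the random offset within
    the block, as the tail bounds expect. *)
Definition hit (x : 'I_d) (g v : nat) : bool :=
  if insub (g %/ slots p) is Some r then
    received r (g %% slots p %/ reps p * 2 ^ blk p + v) == (val x).+1
  else false.

(** Slot [i] of round [r] reads the chunk number [r * slots p + i] of [U], so distinct probes use
    disjoint random bits. *)
Lemma count_received (x : 'I_d) (U : (R * slots p * blk p).-tuple bool) :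
  count_mem (val x).+1
    (flatten [seq slot_values (bits_of (round_sum protocol h U r)) | r <- enum 'I_R])
  = \sum_(g < R * slots p) hit x g (chunk (blk p) (bit_fun U) g).
Proof.
rewrite count_flatten sumnE 2!big_map big_enum /=.
rewrite (big_ord_mul R (slots p) (fun g => hit x g (chunk (blk p) (bit_fun U) g) : nat)).
apply: eq_bigr => r _; rewrite /slot_values count_map -sum1_count.
have -> : iota 0 (slots p) = index_iota 0 (slots p) by rewrite /index_iota subn0.
rewrite big_mkord [LHS]big_mkcond /=.
apply: eq_bigr => i _; rewrite slot_value_received //.
have S0 : 0 < slots p by apply: leq_ltn_trans (ltn_ord i).
rewrite /hit divnMDl // divn_small // addn0 modnMDl modn_small // valK.
by case: eqP.
Qed.

(** The blocks cover all [n * m] positions, and those beyond contribute nothing; the others split by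
    user and sample number. *)
Lemma sum_received r (x : 'I_d) :
  \sum_(pos < blocks p * 2 ^ blk p) (received r pos == (val x).+1)
  = \sum_(j < n) h r j x.
Proof.
have le_nm : n * m <= blocks p * 2 ^ blk p.
  rewrite /blocks {1}(divn_eq (n * m) (2 ^ blk p)) mulnDl mul1n leq_add2l.
  by rewrite ltnW // ltn_mod expn_gt0.
rewrite -(subnKC le_nm) big_split_ord /= [X in _ + X]big1 ?addn0; last first.
  move=> i _; rewrite /received; case: insubP => // j lt_j _; case: ifP => //.
  (* Division by 0 gives 0, so for [m = 0] the position may have an owner, but one without
     samples. *)
  case: (posnP m) => [m0|m_gt0].
    have le0 : m <= 0 by rewrite m0.
    by move=> lt; have := leq_trans (leq_trans lt (h_m r j)) le0.
  by move: lt_j; rewrite ltn_divLR // ltnNge leq_addr.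
rewrite (big_ord_mul n m (fun pos => received r pos == (val x).+1 : nat)).
apply: eq_bigr => j _; rewrite -count_mem_samples -(@sum_nth_count _ m); last first.
  by rewrite size_samples.
apply: eq_bigr => i _.
have m0 : 0 < m by apply: leq_ltn_trans (ltn_ord i).
rewrite /received divnMDl // divn_small // addn0 modnMDl modn_small // valK size_samples.
by case: ifP.
Qed.

(** Each position lies in one block, and that block is probed by [reps p] slots. *)
Lemma sum_hit (x : 'I_d) :
  \sum_(g < R * slots p) \sum_(v < 2 ^ blk p) hit x g v = reps p * total_hist h x.
Proof.
rewrite (big_ord_mul R (slots p) (fun g => \sum_(v < 2 ^ blk p) hit x g v)).
rewrite /total_hist big_distrr /=; apply: eq_bigr => r _; rewrite -(sum_received r x).
rewrite (big_ord_mul (blocks p) (2 ^ blk p) (fun pos => received r pos == (val x).+1 : nat)).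
transitivity (\sum_(i < blocks p * reps p)
    \sum_(v < 2 ^ blk p) (received r (i %/ reps p * 2 ^ blk p + v) == (val x).+1)).
  rewrite [in RHS]mulnC; apply: eq_bigr => i _; apply: eq_bigr => v _.
  have S0 : 0 < slots p by apply: leq_ltn_trans (ltn_ord i).
  by rewrite /hit divnMDl // divn_small // addn0 modnMDl modn_small // valK.
rewrite (big_ord_mul (blocks p) (reps p) (fun i =>
  \sum_(v < 2 ^ blk p) (received r (i %/ reps p * 2 ^ blk p + v) == (val x).+1))).
rewrite big_distrr /=; apply: eq_bigr => q _.
under eq_bigr => i _ do rewrite divnMDl ?reps_gt0 // divn_small // addn0.
by rewrite sum_nat_const card_ord.
Qed.
End Received.
End Protocol.

(** * Failure probability of the protocol *)

Local Open Scope ring_scope.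

(** By [minT] a heavy count is at least [pT p], not only [tau]. As [pT p <= 2 ^ t <= 2 * pT p], the
    mean is at least [20 c] for heavy elements and at most [4 c] for light ones. A union bound over
    the domain concludes. *)
Lemma protocol_solves (F : realType) (p : params) (tau beta : F) :
  0 < tau -> 0 < beta -> tau <= (pT p)%:R -> beta^-1 <= (pb p)%:R ->
  (forall k : nat, tau <= k%:R -> (pT p <= k)%N) ->
  solves_heavy_hitters (pm p) tau beta (protocol p).
Proof.
move=> tau0 beta0 leT leb minT h h_m.
set K := (pR p * slots p * blk p)%N.
set c := conf p; set t := blk p.
pose X (x : 'I_(pd p)) (U : K.-tuple bool) :=
  (\sum_(g < pR p * slots p) hit h x g (chunk t (bit_fun U) g))%N.
pose bad (x : 'I_(pd p)) : pred (K.-tuple bool) :=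
  fun U => if tau <= (total_hist h x)%:R then (X x U < 8 * c)%N
           else ((total_hist h x)%:R <= tau / 10) && (8 * c <= X x U)%N.
have T0 : 0 < (pT p)%:R :> F by apply: lt_le_trans leT.
have t_up : 2 ^+ t <= 2 * (pT p)%:R :> F.
  have /(trunc_logP (isT : (1 < 2)%N)) : (0 < pT p)%N by rewrite -(ltr0n F).
  by rewrite -(ler_nat F) natrX /t /blk /bitlen exprS ler_pM2l.
have t_lo : (pT p)%:R <= 2 ^+ t :> F by rewrite -natrX ler_nat ltnW // ltn_bitlen.
have t0 : 0 < 2 ^+ t :> F by rewrite exprn_gt0.
have card_bad x : #|[pred U | bad x U]|%:R * 2 ^+ c <= 2 ^+ K :> F.
  have mean_E : (\sum_(g < pR p * slots p) \sum_(v < 2 ^ t) hit h x g v)%N%:R =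
      40 * c%:R * (total_hist h x)%:R :> F by rewrite sum_hit // !natrM.
  have [heavy|light] := boolP (tau <= (total_hist h x)%:R).
    rewrite (eq_card (_ : _ =i [pred U | (X x U < 8 * c)%N])); last first.
      by move=> U; rewrite !inE /bad heavy.
    apply: card_hits_lt; rewrite mean_E ler_pdivlMr //.
    have {heavy}heavy : (pT p)%:R <= (total_hist h x)%:R :> F by rewrite ler_nat minT.
    have c0 : 0 <= c%:R :> F by [].
    by nra.
  have [low|nlow] := boolP ((total_hist h x)%:R <= tau / 10).
    rewrite (eq_card (_ : _ =i [pred U | (8 * c <= X x U)%N])); last first.
      by move=> U; rewrite !inE /bad (negbTE light) low.
    apply: card_hits_ge; rewrite mean_E ler_pdivrMr //.
    have c0 : 0 <= c%:R :> F by [].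
    by nra.
  (* Between the two thresholds nothing is required, so nothing is bad. *)
  rewrite (eq_card0 (_ : _ =i pred0)) ?mul0r ?exprn_ge0 //.
  by move=> U; rewrite !inE /bad (negbTE light) (negbTE nlow).
set ok := fun U => _.
have bad_union : {subset [predC [pred U | ok U]] <= [pred U | [exists x, bad x U]]}.
  move=> U; rewrite !inE /ok /heavy_hitters_ok negb_forall => /existsP[x nok].
  apply/existsP; exists x; move: nok; rewrite /bad negb_and !negb_imply inE.
  rewrite !count_received // -/(X x U) /threshold -/c.
  case: (boolP (tau <= _)) => [heavy|light] /=; last by rewrite andbT.
  case/orP; first by rewrite -ltnNge.
  case/and3P=> low _ _; exfalso; move: (le_trans heavy low); rewrite leNgt => /negP; apply.
  by lra.
have card_nok : #|[predC [pred U | ok U]]|%:R * 2 ^+ c <= (pd p)%:R * 2 ^+ K :> F.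
  apply: le_trans (_ : (\sum_(x < pd p) #|[pred U | bad x U]|)%N%:R * 2 ^+ c <= _).
    rewrite ler_pM2r ?exprn_gt0 // ler_nat.
    apply: (@leq_trans #|[pred U : K.-tuple bool | [exists x, bad x U]]|).
      exact/subset_leq_card/fintype.subsetP.
    have cardE (P : pred (K.-tuple bool)) : #|[pred U | P U]| = (\sum_U P U)%N.
      by rewrite -sum1_card big_mkcond; apply: eq_bigr => U _; rewrite inE; case: ifP.
    rewrite cardE (eq_bigr _ (fun x _ => cardE (bad x))) exchange_big /=.
    apply: leq_sum => U _; case: existsP => // -[x bx].
    by rewrite (bigD1 x) //= bx.
  rewrite natr_sum mulr_suml mulr_natl -[in leRHS](card_ord (pd p)) -sumr_const.
  exact: ler_sum.
(* Combines [1 <= beta * pb p] with [pb p * pd p < 2 ^ c], the choice of [conf]. *)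
have le_d : (pd p)%:R <= beta * 2 ^+ c :> F.
  have : (pb p * pd p)%:R <= 2 ^+ c :> F by rewrite -natrX ler_nat ltnW // ltn_bitlen.
  rewrite natrM -(ler_pM2l beta0); apply: le_trans.
  by rewrite mulrA ler_peMl // -ler_pdivrMl // mulr1.
have {}card_nok : #|[predC [pred U | ok U]]|%:R <= beta * 2 ^+ K :> F.
  rewrite -(@ler_pM2r _ (2 ^+ c)) ?exprn_gt0 //; apply: le_trans card_nok _.
  by rewrite mulrAC ler_pM2r ?exprn_gt0.
have card_all : #|{: K.-tuple bool}| = (2 ^ K)%N by rewrite card_tuple card_bool.
rewrite /Prob card_all natrX ler_pdivlMr ?exprn_gt0 //.
have := cardC [pred U | ok U]; rewrite card_all => /(congr1 (fun k => k%:R : F)).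
rewrite natrD natrX => eK; move: card_nok; rewrite -eK.
by move: (#|_|%:R) (#|_|%:R) => a b; lra.
Qed.

(** * The programs realize the protocol *)

Section Running.
Variables (F : realType) (p : params) (B : F).

Lemma bounded_init k (vs : seq nat) (U : k.-tuple bool) :
  {in vs, forall v, (v < 2 ^ word p)%N} -> bounded (word p) (init_state vs U).
Proof.
have one_lt : (1 < 2 ^ word p)%N by rewrite -{1}(expn0 2) ltn_exp2l // word_gt0.
move=> vs_lt; split=> [x|a i] /=.
  case: (ltnP x (size vs)) => [lt_x|/(nth_default 0%N)->]; last by rewrite expn_gt0.
  by apply: vs_lt; rewrite mem_nth.
case: ifP => _; last by rewrite expn_gt0.
case: (ltnP i (size (map nat_of_bool U))) => [lt_i|/(nth_default 0%N)->]; last by rewrite expn_gt0.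
by case/mapP: (mem_nth 0%N lt_i) => b _ ->; case: b; rewrite ?expn_gt0.
Qed.

Lemma bit_fun_le1 u q : (bit_fun u q <= 1)%N.
Proof.
rewrite /bit_fun; case: (ltnP q (size u)) => [lt_q|le_q].
  by rewrite (nth_map false) // leq_b1.
by rewrite nth_default ?size_map.
Qed.

Lemma bounded_set_arr w s a f : bounded w s -> (forall i, (f i < 2 ^ w)%N) ->
  bounded w (set_arr s a f).
Proof. by case=> bv ba bf; split=> //= b i; case: eqP. Qed.

Lemma users_run : (user_cost * word p ^ 3 * blocks p)%:R <= B ->
  users_run_in (pm p) (protocol p) (param_seq p) user B.
Proof.
move=> leB r j h U h_m.
have small v x : v \in param_seq p -> (x <= v)%N -> (x < 2 ^ word p)%N.
  by move=> /param_lt_word lt_v le_x; apply: leq_ltn_trans le_x (ltnW lt_v).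
have bs : bounded (word p) (user_state (param_seq p) r j h U).
  apply: bounded_set_arr; last first.
    move=> i; apply: (@small (pd p)); last exact: nth_samples_le.
    by rewrite !inE eqxx !orbT.
  apply: bounded_init => v; rewrite mem_cat => /orP[v_in|].
    exact: small v_in (leqnn _).
  rewrite !inE => /or3P[] /eqP->.
  - by apply: (@small (pR p)); rewrite ?inE ?eqxx // ltnW.
  - by apply: (@small (pn p)); rewrite ?inE ?eqxx ?orbT // ltnW.
  - by apply: (@small (pm p)); rewrite ?inE ?eqxx ?orbT.
have [||||||||s' [tm x le_t] out] := @runs_user p _ (bit_fun U)
    (nth 0%N (samples h)) r j (norm1 h) _ bs.
- by case=> [|[|[|[|[|[|[]]]]]]].
- by [].
- by [].
- by [].
- by [].
- by [].
- exact: nth_samples_le.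
- exact: bit_fun_le1.
exists tm, s'; split=> //.
  by apply: le_trans leB; rewrite ler_nat.
apply: eq_from_tnth => q; rewrite !tnth_mktuple ffunE out //.
by rewrite modn2 eqb0 negbK.
Qed.

(** Memory persists between rounds, so the induction generalizes over the values [vs] already
    tallied; the size hypothesis budgets the counters for all remaining rounds. *)
Lemma serves_rounds (ys : seq (seq bool)) r s vs :
  (server_cost * word p ^ 3 * blocks p)%:R <= B ->
  has_params p s -> bounded (word p) s -> tallied p vs s ->
  (r + size ys <= pR p)%N -> (size vs + size ys * slots p < 2 ^ word p)%N ->
  exists2 s', serves_in server B r ys s s' &
    tallied p (vs ++ flatten [seq slot_values p y | y <- ys]) s'.
Proof.
move=> leB; elim: ys r s vs => [|y ys IHys] r s vs hp bs tal le_r lt_vs.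
  by exists s => //; rewrite cats0.
have lt_word v : (v <= pR p)%N -> (v < 2 ^ word p)%N.
  by move=> le_v; apply: leq_ltn_trans le_v (ltnW (param_lt_word _)); rewrite !inE eqxx.
have bl : bounded (word p) (load_round s r y).
  apply: bounded_set_arr.
    by apply: bounded_set_var => //; apply: lt_word; move: le_r => /=; lia.
  move=> i; apply: leq_ltn_trans (bit_fun_le1 y i) _.
  by rewrite -{1}(expn0 2) ltn_exp2l // word_gt0.
have [|||||s1 [tm x le_t] [hp1 b1 tal1]] :=
  @runs_server p (load_round s r y) (bit_fun y) vs _ bl.
- by move=> z lt_z; rewrite -hp //=; case: eqP lt_z => // ->.
- by [].
- exact: bit_fun_le1.
- by move: lt_vs => /=; rewrite mulSn; lia.
- by case: tal => t1 t2 t3; split.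
have [||s' sv tal'] := IHys r.+1 s1 _ hp1 b1 tal1.
- by move: le_r => /=; lia.
- rewrite size_cat size_map size_iota; move: lt_vs => /=; rewrite mulSn; lia.
exists s'; last by rewrite /= catA.
by exists tm, s1; split=> //; apply: le_trans leB; rewrite ler_nat.
Qed.

Lemma server_runs : (server_cost * word p ^ 3 * blocks p)%:R <= B ->
  server_runs_in (pm p) (protocol p) (param_seq p) server B.
Proof.
move=> leB h U h_m.
set ys := [seq _ | r <- _].
have size_ys : size ys = pR p by rewrite size_map size_enum_ord.
have [|||||s' sv [_ out _]] := @serves_rounds ys 0 (init_state (param_seq p) U) [::] leB.
- by [].
- by apply: bounded_init => v /param_lt_word/ltnW.
(* The threshold is positive because [conf p] is, so the empty output is right before the first
   round. *)
- split=> // x; rewrite !inE /=.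
  by have -> : (threshold p <= 0)%N = false; rewrite ?andbF // leqNgt muln_gt0.
- by rewrite size_ys.
- by rewrite size_ys rounds_slots_lt.
exists s'; split=> // x; rewrite out !inE /=.
rewrite /ys -map_comp; apply/andP/mapP => [[lt_x cnt]|[z]].
  by exists (Ordinal lt_x) => //; rewrite mem_enum inE.
by rewrite mem_enum inE => cnt ->.
Qed.
End Running.

(** * Polylogarithmic bounds and conclusion *)

(** Since [ln 2 >= 1/2], the binary logarithm is at most [2 * ln A]; the additional 1 in [bitlen] is
    at most [2 * ln A] too, as [A >= 2]. *)
Lemma bitlen_le_ln (F : realType) (A : F) v : 2 <= A -> v%:R <= A ->
  (bitlen v)%:R <= 4 * ln A.
Proof.
move=> A2 vA.
have e2 : expR 2^-1 <= 2 :> F.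
  have h : 2^-1 <= expR (- 2^-1) :> F by apply: le_trans (expR_ge1Dx _); lra.
  by rewrite -[expR _]invrK -expRN -[leRHS]invrK lef_pV2 ?posrE ?expR_gt0 //; lra.
have half_ln2 : 2^-1 <= ln 2 :> F by rewrite -[leLHS]expRK ler_ln ?posrE ?expR_gt0.
have pow_le k : 2 ^+ k <= A -> k%:R * 2^-1 <= ln A.
  move=> le_A; apply: le_trans (_ : k%:R * ln 2 <= _); first by rewrite ler_wpM2l.
  rewrite mulr_natl -lnXn // ler_ln ?posrE ?exprn_gt0 //.
  by apply: lt_le_trans A2.
have lnA : 2^-1 <= ln A by have := pow_le 1%N; rewrite expr1 mul1r; apply.
rewrite /bitlen -addn1 natrD.
suff : (trunc_log 2 v)%:R * 2^-1 <= ln A by lra.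
case: v vA => [|v] vA; first by rewrite trunc_log0 mul0r; lra.
apply: pow_le; apply: le_trans vA.
by rewrite -natrX ler_nat trunc_logP.
Qed.

Definition params_of (F : realType) (R n m d : nat) (tau beta : F) : params :=
  Params R n m d `|Num.ceil tau|%N `|Num.ceil beta^-1|%N.

(** [word p] is 20 times a sum of six bit lengths, each at most [4 * ln A], which gives 480; the
    summand 2 of [A] absorbs the rounding of the ceilings. The block count is bounded through
    [tau <= 2 ^ blk p]. *)
Lemma word_otilde (F : realType) (R n m d : nat) (tau beta : F) (K : nat) :
  0 < tau -> 0 < beta < 1 ->
  (K * word (params_of R n m d tau beta) ^ 3 * blocks (params_of R n m d tau beta))%:R
    <= otilde_bound (K%:R * 480 ^+ 3) 3 R n m d tau beta.
Proof.
move=> tau0 /andP[beta0 beta1]; set p := params_of _ _ _ _ _ _.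
rewrite /otilde_bound; set A : F := 2 + _ + _ + _ + _ + _ + _ + _.
have ib1 : 1 < beta^-1 by rewrite invf_gt1.
have natr0 k : 0 <= k%:R :> F by [].
have ceil_le (x : F) : 0 < x -> (`|Num.ceil x|%N)%:R <= x + 1.
  move=> x0; have := ceil_itv x => /andP[lt_x _].
  rewrite natr_absz gtr0_norm ?ceil_gt0 //.
  by move: lt_x; rewrite intrB; lra.
have A2 : 2 <= A.
  rewrite /A; have := (natr0 m, natr0 n, natr0 R, natr0 (n * R)%N, natr0 d).
  by case=> -[[[? ?] ?] ?] ?; lra.
have le_word : (word p)%:R <= 480 * ln A.
  have b v : v%:R <= A -> (bitlen v)%:R <= 4 * ln A by exact: bitlen_le_ln.
  have := (natr0 m, natr0 n, natr0 R, natr0 (n * R)%N, natr0 d); case=> -[[[? ?] ?] ?] ?.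
  have bR : (bitlen R)%:R <= 4 * ln A by apply: b; rewrite /A; lra.
  have bn : (bitlen n)%:R <= 4 * ln A by apply: b; rewrite /A; lra.
  have bm : (bitlen m)%:R <= 4 * ln A by apply: b; rewrite /A; lra.
  have bd : (bitlen d)%:R <= 4 * ln A by apply: b; rewrite /A; lra.
  have bT : (bitlen (pT p))%:R <= 4 * ln A.
    by apply: b; have := ceil_le _ tau0; rewrite /A /=; lra.
  have bb : (bitlen (pb p))%:R <= 4 * ln A.
    have ib0 : 0 < beta^-1 by lra.
    by apply: b; have := ceil_le _ ib0; rewrite /A /=; lra.
  rewrite /word /word0 natrM !natrD /=.
  by lra.
have le_blocks : (blocks p)%:R <= 1 + m%:R * n%:R / tau.
  rewrite /blocks natrD addrC lerD2l ler_pdivlMr //= -natrM [(m * n)%N]mulnC.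
  apply: le_trans (_ : (n * m %/ 2 ^ blk p)%:R * (2 ^ blk p)%:R <= _).
    rewrite ler_wpM2l //; apply: le_trans (ceil_ge tau) _.
    have -> : (Num.ceil tau)%:~R = (pT p)%:R :> F by rewrite natr_absz gtr0_norm ?ceil_gt0.
    by rewrite ler_nat ltnW // ltn_bitlen.
  by rewrite -natrM ler_nat leq_trunc_div.
rewrite (natrM _ (K * word p ^ 3)) (natrM _ K) natrX -(mulrA K%:R (480 ^+ 3)) -exprMn.
apply: ler_pM => //.
move: (480 : F) le_word => c le_word.
have c0 : 0 <= c * ln A := le_trans (natr0 _) le_word.
apply: (ler_wpM2l (natr0 K)); apply: lerXn2r le_word; by rewrite nnegrE.
Qed.

Lemma slots_width_le p : (slots p * width p <= 40 * word p ^ 3 * blocks p)%N.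
Proof.
have -> : (slots p * width p = 40 * (conf p * width p) * blocks p)%N.
  by rewrite /slots /reps -!mulnA [(blocks p * _)%N]mulnC.
rewrite leq_mul2r leq_mul2l /=; apply/orP; right.
apply: (@leq_trans (word p ^ 2)); last by rewrite leq_pexp2l ?word_gt0.
by apply: leq_mul; apply: ltnW; rewrite ?conf_lt ?width_lt.
Qed.

Theorem theorem1 (F : realType) :
  exists (user server : cmd) (C : F) (c : nat),
  forall (R n m d : nat) (tau beta : F),
    0 < tau -> 0 < beta < 1 ->
    let B := otilde_bound C c R n m d tau beta in
    let ps := param_values R n m d tau beta in
    exists (l K : nat) (P : ni_protocol R n d l K),
      [/\ l%:R <= B,
          solves_heavy_hitters m tau beta P,
          users_run_in m P ps user B &
          server_runs_in m P ps server B].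
Proof.
(* One constant for the message length, the users and the server, so that the same [B] bounds all
   three. *)
pose K := (40 + user_cost + server_cost)%N.
exists user, server, (K%:R * 480 ^+ 3), 3%N => R n m d tau beta tau0 beta01 B ps.
pose p := params_of R n m d tau beta.
have leB k : (k <= K)%N -> (k * word p ^ 3 * blocks p)%:R <= B.
  move=> le_k; apply: le_trans (word_otilde R n m d K tau0 beta01).
  by rewrite ler_nat !leq_mul2r le_k !orbT.
have ceil_natr (x : F) : 0 < x -> (`|Num.ceil x|%N)%:R = (Num.ceil x)%:~R :> F.
  by move=> x0; rewrite natr_absz gtr0_norm ?ceil_gt0.
have [beta0 _] := andP beta01; have ib0 : 0 < beta^-1 by rewrite invr_gt0.
exists (slots p * width p)%N, (R * slots p * blk p)%N, (protocol p); split.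
- apply: le_trans (leB 40%N _); last by rewrite /K -addnA leq_addr.
  by rewrite ler_nat slots_width_le.
- apply: (@protocol_solves F p) => //=; rewrite ?ceil_natr ?ceil_ge // => k le_k.
  (* The ceiling is the least integer that is at least [tau]. *)
  by rewrite -(ler_nat F) ceil_natr // -[k%:R]/(k%:~R) ler_int ceil_le_int.
- by apply: (@users_run F p B); apply: leB; rewrite /K addnAC leq_addl.
- by apply: (@server_runs F p B); apply: leB; rewrite /K leq_addl.
Qed.
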